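(* Let $F \stackrel{\mathrm{loc}}{\ll} G$ and $M := \mathcal{M}^G F$. Suppose that $M$ is integrable on $[0, t_G]$, and let $\Delta\mu := E[M_{t_G}]-E[M_0]$. Then $$\Delta \mu = -\lim_{t \uparrow\uparrow t_G} F(t)\overline{G}(t)\, \mathbf{1}_{\{ \Delta G(t_G) = 0\}},$$ and for $0 \leq s < t_G$, $$E[M_{t_G}\mid\mathcal{F}^\gamma_s] - M_s = \frac{\Delta \mu}{\overline{G}(s)} \mathbf{1}_{\{ s < \gamma\}} \quad P\text{-a.s.}$$ Moreover, $M$ is always an integrable $\mathbb{F}^M$-local $\mathbb{F}^\gamma$-martingale on $[0,t_G]$, and more precisely, (a) $M$ is an $\mathbb{F}^\gamma$-submartingale and a strict local martingale on $[0, t_G]$ if and only if $\Delta \mu > 0$, (b) $M$ is an $\mathbb{F}^\gamma$-martingale on $[0, t_G]$ if and only if $\Delta \mu = 0$, (c) $M$ is an $\mathbb{F}^\gamma$-supermartingale and a strict local martingale on $[0, t_G]$ if and only if $\Delta \mu < 0$.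
   Context: Analytic setting. Fix a distribution function $G:\mathbb{R}\to[0,1]$ (nondecreasing, right-continuous) with $G(0)=0$ and $\lim_{t\to\infty}G(t)=1$; set $G(\infty):=1$. Put $t_G:=\sup\{t\ge 0: G(t)<1\}\in(0,\infty]$, $\overline{G}:=1-G$, $\Delta G(t_G):=G(t_G)-\lim_{t\uparrow\uparrow t_G}G(t)$ (so $\Delta G(t_G)=0$ if $t_G=\infty$). The notation $t\uparrow\uparrow t_G$ means $t\to t_G$ with $t<t_G$, and $F(v-)$ is the left limit of $F$ at $v$. $\mathrm{d}G$ is the Lebesgue--Stieltjes measure on $(0,\infty)$ induced by $G$. A Borel function $F:[0,\infty)\to\mathbb{R}$ satisfies $F\stackrel{\mathrm{loc}}{\ll}G$ if for every $0<b<t_G$ there is a $\mathrm{d}G$-integrable $f:(0,b]\to\mathbb{R}$ with $F(t)-F(0)=\int_{(0,t]}f(v)\,\mathrm{d}G(v)$ for all $t\in(0,b]$. Then there is a Borel function $\frac{\mathrm{d}F}{\mathrm{d}G}:(0,\infty)\to\mathbb{R}$ (local density), $\mathrm{d}G$-a.e. unique on $(0,t_G)$, which serves as such an $f$ for every $b\in(0,t_G)$; moreover $F$ is càdlàg on $[0,t_G)$. Define $\mathcal{A}^G F:(0,\infty)\to\mathbb{R}$ by $\mathcal{A}^G F(v)=F(v-)-\frac{\mathrm{d}F}{\mathrm{d}G}(v)\overline{G}(v)$ for $v\in(0,t_G)$; for $v\ge t_G$, $\mathcal{A}^G F(v)=F(t_G-)\mathbf{1}_{\{\Delta G(t_G)>0\}}$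 if $F(t_G-):=\lim_{t\uparrow\uparrow t_G}F(t)$ exists in $\mathbb{R}$, and $\mathcal{A}^G F(v)=0$ otherwise. Probabilistic setting. $(\Omega,\mathcal{F},P)$ is a probability space and $\gamma$ a $(0,\infty)$-valued random variable with distribution function $G$. $\mathbb{F}^\gamma=(\mathcal{F}^\gamma_t)_{t\in[0,\infty]}$ is the filtration $\mathcal{F}^\gamma_t=\sigma(\{\gamma\le s\}:s\in(0,t])$. The process $\mathcal{M}^G F=(\mathcal{M}^G_t F)_{t\in[0,\infty]}$ is $\mathcal{M}^G_tF=F(t)\mathbf{1}_{\{t<\gamma\}}+\mathcal{A}^G F(\gamma)\mathbf{1}_{\{t\ge\gamma\}}$. For $M=\mathcal{M}^G F$, $\mathbb{F}^M$ is the raw filtration generated by $M$ (the smallest filtration to which $M$ is adapted); it is a subfiltration of $\mathbb{F}^\gamma$. Filtrations are indexed by $[0,\infty]$ and are not assumed to satisfy the usual conditions. Martingale terminology, for an interval $I=[0,T]$ with $T\in(0,\infty]$ and a filtration $\mathbb{F}$: a process $X$ is integrable on $I$ if $E[|X_t|]<\infty$ for all $t\in I$. $X$ is an $\mathbb{F}$-(sub/super)martingale on $I$ if $P$-a.e. path is càdlàg on $I$, $X$ is $\mathbb{F}$-adapted on $I$, integrable on $I$, and $E[X_t|\mathcal{F}_s]=X_s$ (resp. $\ge X_s$, $\le X_s$) a.s. for all $s\le t$ in $I$. For a subfiltration $\mathbb{G}$ of $\mathbb{F}$, $X$ is a $\mathbb{G}$-local $\mathbb{F}$-martingale on $I=[0,T]$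 if there is an increasing sequence of $\mathbb{G}$-stopping times $(\tau_n)$ with values in $[0,T]$ such that each stopped process $X^{\tau_n}$ is an $\mathbb{F}$-martingale on $I$ and $\lim_{n\to\infty}P[\tau_n=T]=1$; a local $\mathbb{F}$-martingale is an $\mathbb{F}$-local $\mathbb{F}$-martingale. $X$ is a martingale (resp. local martingale) on $I$ if it is an $\mathbb{F}'$-martingale (resp. local $\mathbb{F}'$-martingale) on $I$ for some filtration $\mathbb{F}'$ of $\mathcal{F}$; a strict local martingale on $I$ is a local martingale on $I$ that is not a martingale on $I$. *)

(* Defs.v *)
From mathcomp Require Import all_boot all_order all_algebra.
From mathcomp Require Import all_classical all_reals all_analysis.
From mathcomp Require Import measurable_realfun.

Set Implicit Arguments.
Unset Strict Implicit.
Unset Printing Implicit Defensive.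
Import Order.TTheory GRing.Theory Num.Theory.
Import numFieldNormedType.Exports.
Local Open Scope classical_set_scope.
Local Open Scope ring_scope.

(* [t] tends to [T] with [t < T], for [T] real or [T = +oo]; the value at
   [T = -oo] is irrelevant. *)
Definition up_to {R : realType} (T : \bar R) : set_system R :=
  if T is r%:E then r^'- else pinfty_nbhs R.

Instance up_to_proper_filter {R : realType} (T : \bar R) :
  ProperFilter (up_to T).
Proof. by case: T => [r| |]; rewrite /up_to; typeclasses eauto. Qed.

Lemma integrable_setU d (T : measurableType d) (R : realType)
    (mu : {measure set T -> \bar R}) (A B : set T) (f : T -> \bar R) :
  measurable A -> measurable B -> [disjoint A & B] ->
  mu.-integrable A f -> mu.-integrable B f -> mu.-integrable (A `|` B) f.
Proof.
move=> mA mB AB Af Bf.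
have mf := (measurable_funU f mA mB).2
  (conj (measurable_int _ Af) (measurable_int _ Bf)).
apply/integrableP; split=> //; rewrite ge0_integral_setU//; last first.
  exact: measurableT_comp.
by apply: lte_add_pinfty; [case/integrableP : Af|case/integrableP: Bf].
Qed.

Section analytic_setting.
Context {R : realType}.
(* A distribution function [G] on the line; together with the hypothesis
   [G 0 = 0] of the theorem, the limit 0 at -oo is automatic. *)
Variable G : cumulativeBounded (0 : R) (1 : R).

Definition dG : {measure set (measurableTypeR R) -> \bar R} :=
  lebesgue_stieltjes_measure G.

Definition tG : \bar R := ereal_sup [set t%:E | t in [set t | 0 <= t /\ G t < 1]].

Definition Gbar (t : R) : R := 1 - G t.

Definition Gext (t : \bar R) : R :=
  match t with r%:E => G r | +oo%E => 1 | -oo%E => 0 end.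

Definition jump_tG : R := Gext tG - lim (G t @[t --> up_to tG]).

(* Functions on [0, oo) or (0, oo) are represented by functions on [R] whose
   values elsewhere are never used. *)
Definition density_on (F f : R -> R) (b : R) : Prop :=
  dG.-integrable `]0, b] (EFin \o f) /\
  forall t, 0 < t <= b ->
    (F t - F 0)%:E = (\int[dG]_(v in `]0%R, t]) (f v)%:E)%E.

Definition loc_abs_cont (F : R -> R) : Prop :=
  measurable_fun `[(0 : R), +oo[ F /\
  forall b : R, 0 < b -> (b%:E < tG)%E -> exists f, density_on F f b.

Definition local_density (F f : R -> R) : Prop :=
  measurable_fun `](0 : R), +oo[ f /\
  forall b : R, 0 < b -> (b%:E < tG)%E -> density_on F f b.

Lemma density_on_patch (F f g : R -> R) (a b : R) : 0 < a -> a <= b ->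
  density_on F f a -> density_on F g b ->
  density_on F (fun v => if v <= a then f v else g v) b.
Proof.
move=> a0 ab [fi fE] [gi gE]; set k := fun v => _.
have kf t : t <= a -> {in `]0, t]%classic, (EFin \o f) =1 (EFin \o k)}.
  move=> ta v; rewrite inE/= in_itv/= => /andP[_ vt].
  by rewrite /k (le_trans vt ta).
have kg t : {in `]a, t]%classic, (EFin \o g) =1 (EFin \o k)}.
  by move=> v; rewrite inE/= in_itv/= => /andP[av _]; rewrite /k leNgt av.
have split0 t : a <= t -> `]0, t]%classic = `]0, a] `|` `]a, t].
  move=> at_; apply/seteqP; split=> v /=; rewrite !in_itv/=.
    by move=> /andP[v0 vt]; case: (leP v a) => va; [left|right]; rewrite ?v0 ?vt.
  by case=> /andP[x y]; rewrite ?x ?y ?(le_trans y at_)// (lt_trans a0 x).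
have disj t : [disjoint `]0, a]%classic & `]a, t]%classic].
  apply/disj_setPS => v /=; rewrite !in_itv/= => -[/andP[_ va] /andP[av _]].
  by move: (le_lt_trans va av); rewrite ltxx.
have sub t : t <= b -> `]a, t] `<=` `]0, b].
  move=> tb v /=; rewrite !in_itv/= => /andP[av vt].
  by rewrite (lt_trans a0 av) (le_trans vt tb).
have k1 : dG.-integrable `]0, a] (EFin \o k).
  by apply: eq_integrable fi => //; exact: kf.
have k2 : dG.-integrable `]a, b] (EFin \o k).
  have gi2 : dG.-integrable `]a, b] (EFin \o g).
    by apply: integrableS gi => //; exact: sub.
  by apply: eq_integrable gi2 => //; exact: kg.
have ki : dG.-integrable `]0, b] (EFin \o k).
  by rewrite split0//; apply: integrable_setU.
split=> // t /andP[t0 tb].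
have gi' : dG.-integrable `]0, t] (EFin \o g).
  by apply: integrableS gi => // v /=; rewrite !in_itv/= => /andP[-> /le_trans->].
have ki' : dG.-integrable `]0, t] (EFin \o k).
  by apply: integrableS ki => // v /=; rewrite !in_itv/= => /andP[-> /le_trans->].
have [ta|at_] := leP t a.
  rewrite fE ?t0//; apply: eq_integral => v /(kf _ ta) /=; exact.
have atw := ltW at_.
have eg := gE t; have ega := gE a; have efa := fE a.
rewrite a0 lexx in efa; rewrite a0 ab in ega; rewrite t0 tb in eg.
rewrite (split0 _ atw) integral_setU//; first last.
  by rewrite -split0//; exact: measurable_int ki'.
have -> : (\int[dG]_(v in `]0%R, a]) (k v)%:E =
    \int[dG]_(v in `]0%R, a]) (f v)%:E)%E.
  by apply: eq_integral => v /(kf _ (lexx a)) /= ->.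
have -> : (\int[dG]_(v in `]a, t]) (k v)%:E =
    \int[dG]_(v in `]a, t]) (g v)%:E)%E.
  by apply: eq_integral => v /kg /= ->.
rewrite -efa//.
have := eg isT; rewrite (split0 _ atw) integral_setU//; first last.
  by rewrite -split0//; exact: measurable_int gi'.
by rewrite -ega// => <-.
Qed.

Lemma local_density_exists (F : R -> R) :
  loc_abs_cont F -> exists f, local_density F f.
Proof.
move=> [_ hF].
have [[b0 /andP[b00 b0G]]|nob] := pselect (exists b : R, (0 < b) && (b%:E < tG)%E); last first.
  exists (cst 0); split; first exact: measurable_cst.
  by move=> b b0 bG; case: nob; exists b; rewrite b0.
have [b [bp bG bS bE]] : exists b : nat -> R,
  [/\ forall n, 0 < b n, forall n, ((b n)%:E < tG)%E,
      forall n, b n <= b n.+1 &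
      forall x, (x%:E < tG)%E -> exists n, x <= b n].
  move: b0G; case: tG => [r| |]//; rewrite ?lte_fin => b0r.
  - have r0 := lt_trans b00 b0r.
    exists (fun n => r - r / n.+2%:R); split => [n|n|n|x].
    + rewrite subr_gt0 ltr_pdivrMr// ltr_pMr// ltr1n//.
    + by rewrite lte_fin ltrBlDr ltrDl divr_gt0.
    + by rewrite lerD2l lerN2 ler_pM2l// lef_pV2 ?posrE// ler_nat.
    + rewrite lte_fin => xr; have rx : 0 < r - x by rewrite subr_gt0.
      have := archi_boundP (divr_ge0 (ltW r0) (ltW rx)).
      set n := Num.bound _ => hn; exists n.
      rewrite lerBrDr addrC -lerBrDr ler_pdivrMr// mulrC -ler_pdivrMr//.
      by apply: (le_trans (ltW hn)); rewrite ler_nat ltnW.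
  - exists (fun n => n.+1%:R); split => [n|n|n|x _] //.
    + by rewrite ltry.
    + by rewrite ler_nat.
    + exists (Num.bound `|x|); apply: (le_trans (ler_norm x)).
      apply: (le_trans (ltW (archi_boundP (normr_ge0 x)))).
      by rewrite ler_nat.
have /choice[f fP] : forall n, exists f, density_on F f (b n).
  by move=> n; exact: hF.
pose g := fix g n := if n is m.+1 then
  (fun v => if v <= b m then g m v else f m.+1 v) else f 0%N.
have gP n : density_on F (g n) (b n).
  by elim: n => [|n ih] /=; [exact: fP|apply: density_on_patch].
have bmono m n : (m <= n)%N -> b m <= b n.
  by move=> mn; exact: (homo_leq (lexx) (@le_trans _ _) bS).
have gS m n v : (m <= n)%N -> v <= b m -> g n v = g m v.
  elim: n => [|n ih]; first by rewrite leqn0 => /eqP ->.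
  rewrite leq_eqVlt => /orP[/eqP->//|]; rewrite ltnS => mn vm /=.
  by rewrite (le_trans vm (bmono _ _ mn)) ih.
pose h n := (g n) \_ `]0, b n].
pose k v := if (0 < v) && (v%:E < tG)%E then g (xget 0%N [set n | v <= b n]) v else 0.
have kg n v : 0 < v -> v <= b n -> k v = g n v.
  move=> v0 vn.
  have vG : (v%:E < tG)%E by apply: le_lt_trans (bG n); rewrite lee_fin.
  rewrite /k v0 vG /=.
  have := @xgetPex _ 0%N [set n | v <= b n] (ex_intro _ n vn).
  set m := xget _ _ => /= vm.
  by have [mn|/ltnW nm] := leqP m n; [rewrite (gS m n)|rewrite (gS n m)].
have hk v : h n v @[n --> \oo] --> k v.
  have [/andP[v0 vG]|nv] := boolP ((0 < v) && (v%:E < tG)%E).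
    have [N vN] := bE _ vG.
    apply: cvg_near_cst; exists N => // n /= Nn.
    have vn := le_trans vN (bmono _ _ Nn).
    rewrite /h patchE mem_set/=; last by rewrite in_itv/= v0.
    by rewrite (kg n).
  apply: cvg_near_cst; apply: nearW => n.
  rewrite /k (negbTE nv) /h patchE memNset//= in_itv/= => /andP[v0 vn].
  by move: nv; rewrite v0 (le_lt_trans _ (bG n)).
exists k; split.
  apply: (@measurable_funS _ _ _ _ setT) => //.
  apply: (@measurable_fun_cvg _ _ _ _ h) => // n.
  have [gi _] := gP n; have gm : measurable_fun `]0, b n] (g n).
    by apply/measurable_EFinP; exact: measurable_int gi.
  by apply: (measurable_restrictT (g n) _).1 => //.
move=> c c0 cG; have [n cn] := bE _ cG.
have [gi gE] := gP n.
have ek t : t <= c -> {in `]0, t]%classic, (EFin \o g n) =1 (EFin \o k)}.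
  move=> tc v; rewrite inE/= in_itv/= => /andP[v0 vt].
  by rewrite /= (kg n)// (le_trans vt)// (le_trans tc).
split.
  have gi2 : dG.-integrable `]0, c] (EFin \o g n).
    apply: integrableS gi => // v /=.
    by rewrite !in_itv/= => /andP[-> /le_trans->].
  by apply: eq_integrable gi2 => //; exact: ek.
move=> t /andP[t0 tc]; rewrite gE ?t0 ?(le_trans tc)//.
by apply: eq_integral => v /(ek _ tc).
Qed.

(* [dF] stands for a version of the local density dF/dG. *)
Definition AG (F dF : R -> R) (v : R) : R :=
  if (v%:E < tG)%E then lim (F u @[u --> v^'-]) - dF v * Gbar v
  else if `[< cvg (F u @[u --> up_to tG]) >] then
    lim (F u @[u --> up_to tG]) * (0 < jump_tG)%R%:R
  else 0.

End analytic_setting.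

Section martingales.
Context {d : measure_display} {Omega : measurableType d} {R : realType}.
Variable P : probability Omega R.
Implicit Types (S : set (set Omega)) (FF GG : \bar R -> set (set Omega)).
Implicit Types (X : \bar R -> Omega -> R) (T : \bar R).
Local Open Scope ereal_scope.

(* Processes and filtrations are indexed by [0, +oo]; their values at negative
   indices are never used. *)
Definition is_filtration FF : Prop :=
  (forall t, 0 <= t -> sigma_algebra setT (FF t) /\ FF t `<=` measurable) /\
  (forall s t, 0 <= s -> s <= t -> FF s `<=` FF t).

Definition subfiltration GG FF : Prop :=
  forall t, 0 <= t -> GG t `<=` FF t.

Definition measurable_wrt S (Y : Omega -> R) : Prop :=
  forall B : set R, measurable B -> S (Y @^-1` B).

(* [Y] is a version of E[Z | S]. Versions exist for integrable [Z] and are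
   a.s. unique; an a.s. relation involving E[Z | S] is stated below for some
   version, so it cannot hold vacuously. *)
Definition is_cond_exp S (Z Y : Omega -> R) : Prop :=
  [/\ measurable_wrt S Y,
      P.-integrable setT (EFin \o Y) &
      forall A, S A -> \int[P]_(w in A) (Y w)%:E = \int[P]_(w in A) (Z w)%:E].

Definition generated_filtration X (t : \bar R) : set (set Omega) :=
  <<s [set A | exists s, [/\ 0 <= s, s <= t &
         exists2 B : set R, measurable B & A = X s @^-1` B]] >>.

Definition cadlag_on T (x : \bar R -> R) : Prop :=
  (forall t : R, (0 <= t)%R -> t%:E < T -> x u%:E @[u --> t^'+] --> x t%:E) /\
  (forall t : \bar R, 0 < t -> t <= T -> cvg (x u%:E @[u --> up_to t])).

Definition adapted_on T FF X : Prop :=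
  forall t, 0 <= t -> t <= T -> measurable_wrt (FF t) (X t).

Definition integrable_on T X : Prop :=
  forall t, 0 <= t -> t <= T -> P.-integrable setT (EFin \o X t).

(* Common part of the three definitions below: [rel E[X_t | FF_s] X_s] holds
   a.s. for all s <= t in [0, T]. *)
Definition rel_martingale_on (rel : R -> R -> Prop) T FF X : Prop :=
  [/\ is_filtration FF,
      {ae P, forall w, cadlag_on T (X ^~ w)},
      adapted_on T FF X,
      integrable_on T X &
      forall s t, 0 <= s -> s <= t -> t <= T ->
        exists2 Y, is_cond_exp (FF s) (X t) Y &
                   {ae P, forall w, rel (Y w) (X s w)}].

Definition martingale_on := rel_martingale_on (fun y x => y = x).
Definition submartingale_on := rel_martingale_on (fun y x => (x <= y)%R).
Definition supermartingale_on := rel_martingale_on (fun y x => (y <= x)%R).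

Definition stopping_time GG T (tau : Omega -> \bar R) : Prop :=
  (forall w, 0 <= tau w <= T) /\
  (forall t, 0 <= t -> GG t [set w | tau w <= t]).

Definition stopped X (tau : Omega -> \bar R) (t : \bar R) (w : Omega) : R :=
  X (Order.min t (tau w)) w.

(* [X] is a [GG]-local [FF]-martingale on [0, T]. *)
Definition local_martingale_on GG FF T X : Prop :=
  [/\ is_filtration FF, is_filtration GG, subfiltration GG FF &
      exists tau : nat -> Omega -> \bar R,
        [/\ forall n, stopping_time GG T (tau n),
            forall n w, tau n w <= tau n.+1 w,
            forall n, martingale_on T FF (stopped X (tau n)) &
            P [set w | tau n w = T] @[n --> \oo] --> 1]].

Definition strict_local_martingale_on T X : Prop :=
  (exists FF, local_martingale_on FF FF T X) /\
  ~ (exists FF, martingale_on T FF X).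

End martingales.

Section single_jump.
Context {d : measure_display} {Omega : measurableType d} {R : realType}.
Variable gamma : Omega -> R.

(* [s] ranges over (0, t] including [s = +oo] when [t = +oo]. *)
Definition Fgamma (t : \bar R) : set (set Omega) :=
  <<s [set A | exists s : \bar R, [/\ (0 < s)%E, (s <= t)%E &
         A = [set w | ((gamma w)%:E <= s)%E]]] >>.

(* At [t = +oo] the indicator of {t < gamma} vanishes, so that the junk value
   [F (fine +oo)] is harmless. *)
Definition MG (G : cumulativeBounded (0 : R) (1 : R)) (F dF : R -> R)
    (t : \bar R) (w : Omega) : R :=
  F (fine t) * (t < (gamma w)%:E)%E%:R +
  AG G F dF (gamma w) * ((gamma w)%:E <= t)%E%:R.

End single_jump.

(* Main.v *)
From HB Require Import structures.
Require Import Defs.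
From mathcomp Require Import all_boot all_order all_algebra.
From mathcomp Require Import all_classical all_reals all_analysis.
From mathcomp Require Import measurable_realfun ring lra.
Set Implicit Arguments.
Unset Strict Implicit.
Unset Printing Implicit Defensive.
Import Order.TTheory GRing.Theory Num.Theory.
Import numFieldNormedType.Exports.
Local Open Scope classical_set_scope.
Local Open Scope ring_scope.

(** Integration by parts turns the local density into an exact formula: for
    [0 <= t < tG], the integral of [AG] over [(0, t]] against [dG] is
    [F 0 - F t * Gbar t]. It comes from Fubini's theorem for
    [f u * 1_(u < v <= t)] on the product [dG x dG], where [f = dF/dG]
    ([density_double_integral], [AG_integral]). Since [M t] equals [F t] before
    the jump, and [AG gamma] from the jump on, the formula says that
    [E[M t] = F 0] for every [t < tG] ([integral_MG_lt]). Letting [t] tend to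
    [tG], dominated convergence shows that [F t * Gbar t] converges, and that its
    limit [L] is minus the defect [dmu] when [dG] has no atom at [tG]; an atom at
    [tG] has mass [j > 0] and carries the value [AG = L / j], which contributes
    exactly [L], so that [dmu = 0] ([AG_integral_total], [dmuE]).

    Conditional expectations reduce to expectations. An event of [Fgamma s]
    contains [{s < gamma}] or is disjoint from it ([Fgamma_atom]); on
    [{gamma <= s}], [M s] and [M t] agree for [s <= t]. Hence an
    [Fgamma s]-measurable variable that equals [M t] on [{gamma <= s}] is a
    version of [E[M t | Fgamma s]] as soon as it has the same mean as [M t] ([cond_exp_after_jump]). So
    [M s + c * 1_(s < gamma)] is such a version, with [c] fixed by the means:
    [c = 0] if [t < tG], and [c = dmu / Gbar s] if [s < t = tG]
    ([MG_cond_exp]). The sign of [dmu] therefore decides between submartingale,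
    martingale and supermartingale; conversely, each of these properties, in any
    filtration, constrains the sign of [dmu] by comparing the means at [0] and at
    [tG] ([submartingale_dmu], [supermartingale_dmu], [martingale_dmu]).

    For the local martingale property only [dmu <> 0] needs work. Take [u n]
    increasing to [tG]. Stopping [M] at the constant time [u n] gives a
    martingale, but constant times do not reach [tG], and the filtration of [M]
    need not see the jump. The localizing time [loc_time n] is [u n] as long as
    [M (u k) = F (u k)] for all [k <= n], and [tG] otherwise. If it is [tG], then
    the jump has occurred by time [u n] and [M] is constant afterwards, so [M]
    stopped at [loc_time n] is still [M] stopped at [u n]
    ([stopped_loc_time]). If it never were [tG] on a path with [gamma < tG], then
    [F (u n)] would be eventually equal to the constant [AG gamma], and
    [F (u n) * Gbar (u n)] would tend to [0], whereas it tends to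
    [L = - dmu <> 0] ([loc_time_cvg]). *)

(** * Left neighbourhoods of a finite or infinite endpoint *)

Section up_to_filter.
Context {R : realType}.
Implicit Types (T : \bar R) (g : R -> R).

Lemma up_to_lt T : T != -oo%E -> \forall x \near up_to T, (x%:E < T)%E.
Proof.
case: T => [r| |]// _; last by apply: nearW => x; rewrite ltry.
near do rewrite lte_fin.
exact: nbhs_left_lt.
Unshelve. all: by end_near. Qed.

Lemma up_to_gt T (a : R) : (a%:E < T)%E -> \forall x \near up_to T, a < x.
Proof.
case: T => [r| |]//; first by rewrite lte_fin => ar; exact: nbhs_left_gt.
by move=> _; apply: nbhs_pinfty_gt; exact: num_real.
Qed.

(** Dominated convergence speaks of sequences; this reduction makes it available
    for [t] increasing to a real or infinite endpoint, without a case
    distinction. *)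
Lemma cvg_up_to_seqP T g (l : R) : T != -oo%E ->
  (forall u : R^nat, (forall n, ((u n)%:E < T)%E) ->
     (forall a, (a%:E < T)%E -> \forall n \near \oo, a < u n) ->
     g (u n) @[n --> \oo] --> l) ->
  g x @[x --> up_to T] --> l.
Proof.
case: T => [r| |]// _ H.
  apply/cvg_at_leftP => u [ur uc]; apply: H => [n|a]; first by rewrite lte_fin.
  by rewrite lte_fin => ar; exact: (cvgr_gt r).
apply/cvg_pinftyP => u uc; apply: H => [n|a _]; first by rewrite ltry.
by move/cvgryPgt: uc; exact.
Qed.

Lemma near_up_toP T (A : set R) : T != -oo%E -> (\forall x \near up_to T, A x) ->
  exists a : R, (a%:E < T)%E /\ forall x, a < x -> (x%:E < T)%E -> A x.
Proof.
case: T => [r| |]// _ nA.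
  have [e /= e0 eA] := nA.
  exists (r - e); split; first by rewrite lte_fin ltrBlDr ltrDl.
  move=> x; rewrite lte_fin => ax xr; apply: eA => //=.
  by rewrite ger0_norm ?subr_ge0 ?ltW// ltrBlDr -ltrBlDl.
have [M [_ MA]] := nA.
by exists M; split; rewrite ?ltry// => x Mx _; exact: MA.
Qed.

Lemma cvg_up_to_seq T g (l : R) (u : R^nat) : T != -oo%E ->
  (forall n, ((u n)%:E < T)%E) ->
  (forall a, (a%:E < T)%E -> \forall n \near \oo, a < u n) ->
  g x @[x --> up_to T] --> l -> g (u n) @[n --> \oo] --> l.
Proof.
move=> TN uT ua gl; apply: cvg_comp gl => A /(near_up_toP TN)[a [aT aA]].
change (\forall n \near \oo, A (u n)).
by near=> n; apply: aA => //; near: n; exact: ua.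
Unshelve. all: by end_near. Qed.

Lemma increasing_to (T : \bar R) : (0 < T)%E -> exists u : R^nat,
  [/\ forall n, 0 <= u n, forall n, ((u n)%:E < T)%E,
      nondecreasing_seq u &
      forall a, (a%:E < T)%E -> \forall n \near \oo, a < u n].
Proof.
case: T => [r| |]//.
- rewrite lte_fin => r0.
  exists (fun n => r - r / n.+1%:R); split => [n|n|m n mn|a].
  + by rewrite subr_ge0 ler_pdivrMr// ler_pMr// ler1n.
  + by rewrite lte_fin ltrBlDr ltrDl divr_gt0.
  + by rewrite lerD2l lerN2 ler_pM2l// lef_pV2 ?posrE// ler_nat.
  + rewrite lte_fin => ar.
    have : r - r / n.+1%:R @[n --> \oo] --> r - r * 0.
      by apply: cvgB; [exact: cvg_cst|apply: cvgMr; exact: cvg_harmonic].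
    by rewrite mulr0 subr0 => /cvgr_gt; exact.
- move=> _; exists (fun n => n%:R); split => [n|n|m n mn|a _] //.
  + by rewrite ltry.
  + by rewrite ler_nat.
  + exact: nbhs_infty_gtr.
Qed.

Lemma lt_up_to_between T (t : R) : (t%:E < T)%E ->
  exists b, t < b /\ (b%:E < T)%E.
Proof.
move=> tT; have TN : T != -oo%E by rewrite gt_eqF// (lt_trans _ tT)// ltNyr.
apply: (@filter_ex _ (up_to T)); apply: filterI; [exact: up_to_gt|exact: up_to_lt].
Qed.

(** At times beyond [U] the stopped path is constant, and before [U] it
    coincides with [x] on a whole neighbourhood. *)
Lemma cadlag_on_min (T U : \bar R) (x : \bar R -> R) : (U <= T)%E ->
  cadlag_on T x -> cadlag_on T (fun t => x (Order.min t U)).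
Proof.
move=> UT [xr xl]; split=> /= t t0 tT.
  have [tU|Ut] := ltP t%:E U.
    have [b [tb bU]] := lt_up_to_between tU.
    have := xr t t0 tT; apply: cvg_trans; apply: near_eq_cvg; near=> u.
    rewrite min_l// ltW// (lt_trans _ bU)// lte_fin; near: u.
    exact: nbhs_right_lt.
  apply: cvg_near_cst; near=> u; rewrite min_r// (le_trans Ut)// lee_fin ltW//.
have tN : t != -oo%E by rewrite gt_eqF// (lt_trans _ t0)// ltNyr.
have [tU|Ut] := leP t U.
  have /cvg_ex[l tl] := xl t t0 tT; apply/cvg_ex; exists l.
  apply: cvg_trans tl; apply: near_eq_cvg; near=> u.
  rewrite min_l// ltW// (lt_le_trans _ tU)//; near: u; exact: up_to_lt.
case: U UT Ut => [r| |] UT Ut; last 2 first.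
- by move: Ut; rewrite ltNge leey.
- apply/cvg_ex; exists (x (-oo%E)); apply: cvg_near_cst; apply: nearW => u.
  by rewrite min_r// leNye.
apply/cvg_ex; exists (x r%:E); apply: cvg_near_cst; near=> u.
rewrite min_r// lee_fin ltW//; near: u; exact: up_to_gt.
Unshelve. all: by end_near. Qed.

End up_to_filter.

(** * Integrals over [(0, t]] as functions of [t] *)

Lemma ae_le_integral d (T : measurableType d) (R : realType)
    (mu : {measure set T -> \bar R}) (f g : T -> R) :
  mu.-integrable setT (EFin \o f) -> mu.-integrable setT (EFin \o g) ->
  {ae mu, forall w, f w <= g w} ->
  (\int[mu]_w (f w)%:E <= \int[mu]_w (g w)%:E)%E.
Proof.
move=> fi gi [N [mN muN Nfg]].
have mCN : measurable (setT `\` N) by exact: measurableD.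
rewrite (negligible_integral mN measurableT fi muN).
rewrite (negligible_integral mN measurableT gi muN).
apply: le_integral => //.
- by apply: integrableS fi.
- by apply: integrableS gi.
move=> w /set_mem[_ nN]; rewrite /= lee_fin; apply: contrapT => nfg.
exact/nN/Nfg.
Qed.

Section limits_of_integrals.
Context {R : realType} (mu : {measure set (measurableTypeR R) -> \bar R}).
Implicit Types (T : \bar R) (h : R -> R).

(** The open interval [(0, T)], uniformly for [T] real and [T = +oo]. *)
Definition before T : set R := [set v | 0 < v /\ (v%:E < T)%E].

Lemma measurable_before T : measurable (before T : set (measurableTypeR R)).
Proof.
case: T => [r| |].
- rewrite (_ : before _ = `]0, r[%classic)//.
  by apply/seteqP; split=> v /=; rewrite /before/= in_itv/= lte_fin => /andP.
- rewrite (_ : before _ = `]0, +oo[%classic)//.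
  apply/seteqP; split=> v /=; rewrite /before/= in_itv/= andbT ?ltry; by [case|].
- rewrite (_ : before _ = set0)//.
  by apply/seteqP; split=> v //= -[].
Qed.

(** The restrictions of [h] to [E n] are dominated by [|h|] and are, at each point,
    eventually equal to the restriction of [h] to [E0]. *)
Lemma Rintegral_cvg_seq (D : set R) (E : (set R)^nat) (E0 : set R) h :
  measurable (D : set (measurableTypeR R)) ->
  (forall n, measurable (E n : set (measurableTypeR R))) ->
  measurable (E0 : set (measurableTypeR R)) ->
  (forall n, E n `<=` D) -> E0 `<=` D ->
  (forall v, D v -> \forall n \near \oo, E n v <-> E0 v) ->
  mu.-integrable D (EFin \o h) ->
  \int[mu]_(v in E n) h v @[n --> \oo] --> \int[mu]_(v in E0) h v.
Proof.
move=> mD mE mE0 ED E0D cE hi.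
have int_n A : A `<=` D -> \int[mu]_(v in A) h v = \int[mu]_(v in D) (h \_ A) v.
  by move=> AD; rewrite -Rintegral_mkcondr setIidr.
have mh A : measurable (A : set (measurableTypeR R)) -> A `<=` D ->
    measurable_fun D (EFin \o (h \_ A)).
  move=> mA AD; apply/measurable_EFinP.
  have mhD : measurable_fun D h by apply/measurable_EFinP; exact: measurable_int hi.
  apply/(measurable_restrict h) => //.
  by apply: measurable_funS mhD => //; exact: subIsetl.
have key : (\int[mu]_(v in D) (EFin \o (h \_ (E n))) v)%E @[n --> \oo] -->
    (\int[mu]_(v in D) (EFin \o (h \_ E0)) v)%E.
  have [//|||//||//] := @dominated_convergence _ _ _ mu D mD
     (fun n => EFin \o (h \_ (E n))) (EFin \o (h \_ E0)) (abse \o (EFin \o h)).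
  - by move=> n; exact: mh.
  - exact: mh.
  - apply: aeW => v Dv; apply: cvg_near_cst.
    near=> n; rewrite /= !patchE.
    have nE : E n v <-> E0 v by near: n; exact: cE.
    congr (if _ then _ else _)%:E.
    by apply/idP/idP; rewrite !inE => /nE.
  - exact: integrable_abse.
  - apply: aeW => v n Dv; rewrite /= patchE; case: ifP => // _.
    by rewrite normr0 lee_fin.
under eq_cvg do rewrite int_n//.
rewrite int_n//; apply: fine_cvg; rewrite fineK//.
apply: integrable_fin_num => //.
have := le_integrable mD (mh _ mE0 E0D) _ hi; apply => v Dv /=.
by rewrite patchE; case: ifP => // _; rewrite normr0 lee_fin.
Unshelve. all: by end_near. Qed.

Lemma Rintegral_cvg_up_to T h : T != -oo%E ->
  mu.-integrable (before T) (EFin \o h) ->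
  \int[mu]_(v in `]0, x]) h v @[x --> up_to T] --> \int[mu]_(v in before T) h v.
Proof.
move=> TN hi; apply: cvg_up_to_seqP => // u uT ua.
apply: (@Rintegral_cvg_seq (before T)) => //; try exact: measurable_before.
- move=> n v /=; rewrite in_itv/= => /andP[v0 vu]; split=> //.
  by apply: le_lt_trans (uT n); rewrite lee_fin.
- move=> v [v0 vT]; near=> n; split=> // _; rewrite /= in_itv/= v0/=.
  by apply/ltW; near: n; exact: (ua _ vT).
Unshelve. all: by end_near. Qed.

Lemma Rintegral_cvg_right (t b : R) h : t < b ->
  mu.-integrable `]0, b] (EFin \o h) ->
  \int[mu]_(v in `]0, x]) h v @[x --> t^'+] --> \int[mu]_(v in `]0, t]) h v.
Proof.
move=> tb hi.
have H : \int[mu]_(v in `]0, Num.min x b]) h v @[x --> t^'+] -->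
    \int[mu]_(v in `]0, t]) h v.
  (* sequences converging to t from the right may start beyond b *)
  apply/cvg_at_rightP => u [ut uc].
  apply: (@Rintegral_cvg_seq `]0, b]%classic) => //.
  - move=> n v /=; rewrite !in_itv/= => /andP[-> /=].
    by rewrite le_min => /andP[].
  - by move=> v /=; rewrite !in_itv/= => /andP[-> /le_trans->//]; exact: ltW.
  - move=> v /=; rewrite in_itv/= => /andP[v0 vb].
    have [vt|tv] := leP v t.
      apply: nearW => n; rewrite /= !in_itv/= v0/= le_min vb vt andbT.
      by rewrite (le_trans vt)// ltW.
    near=> n; have uv : u n < v by near: n; exact: (cvgr_lt t).
    by rewrite /= !in_itv/= v0/= le_min vb andbT !leNgt tv uv.
apply: cvg_trans H; apply: near_eq_cvg.
near=> x; rewrite min_l//; apply/ltW; near: x; exact: nbhs_right_lt.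
Unshelve. all: by end_near. Qed.

End limits_of_integrals.

(** * The distribution function and its measure *)

Lemma itv_oc_setD (R : realType) (a b : R) :
  `]a, b]%classic = `]-oo, b] `\` `]-oo, a] :> set R.
Proof.
apply/seteqP; split=> v /=; rewrite !in_itv/=.
  by move=> /andP[av vb]; split=> //; apply/negP; rewrite -ltNge.
by move=> [vb /negP]; rewrite -ltNge => ->.
Qed.

Section distribution_function.
Context {R : realType} (G : cumulativeBounded (0 : R) (1 : R)).
Hypothesis G0 : G 0 = 0.

Lemma G_nondecreasing (s t : R) : s <= t -> G s <= G t.
Proof. exact: cumulative_is_nondecreasing. Qed.

Lemma G_right_continuous : right_continuous G.
Proof. exact: cumulative_is_right_continuous. Qed.

Lemma G_le1 (t : R) : G t <= 1.
Proof.
rewrite leNgt; apply/negP => G1.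
have : G x @[x --> +oo] --> (1 : R) by exact: cumulativey.
move=> /cvgr_lt/(_ _ G1) H.
have [] // : exists x : R, False.
apply: (@filter_ex _ (pinfty_nbhs R)); near=> x.
have : G t <= G x.
  by apply: G_nondecreasing; near: x; exact/nbhs_pinfty_ge/num_real.
by rewrite leNgt => /negP; apply; near: x.
Unshelve. all: by end_near. Qed.

Lemma G_ge0 (t : R) : 0 <= t -> 0 <= G t.
Proof. by move=> t0; rewrite -[leLHS]G0; exact: G_nondecreasing. Qed.

Lemma tG_gt0 : (0 < tG G)%E.
Proof.
have G01 : G 0 < 1 by rewrite G0.
have := cvgr_lt _ (@G_right_continuous 0) _ G01 => nG.
have [x [x0 Gx]] : exists x : R, 0 < x /\ G x < 1.
  apply: (@filter_ex _ (at_right (0 : R))); near=> x; split; near: x; last exact: nG.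
  exact: nbhs_right_gt.
apply: (@lt_le_trans _ _ x%:E); first by rewrite lte_fin.
by apply: ereal_sup_ubound; exists x => //; split=> //; exact: ltW.
Unshelve. all: by end_near. Qed.

Lemma tG_neqNy : tG G != -oo%E.
Proof. by rewrite gt_eqF// (lt_trans _ tG_gt0)// ltNyr. Qed.

Lemma Gbar_gt0 (t : R) : (t%:E < tG G)%E -> 0 < Gbar G t.
Proof.
move=> /ereal_sup_gt[_ [s [s0 Gs] <-]]; rewrite lte_fin => ts.
by rewrite subr_gt0 (le_lt_trans _ Gs)// G_nondecreasing// ltW.
Qed.

Lemma G_ge_tG (t : R) : (tG G <= t%:E)%E -> G t = 1.
Proof.
move=> Gt.
have t0 : 0 < t by rewrite -lte_fin (lt_le_trans tG_gt0).
have H s : t < s -> G s = 1.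
  move=> ts; apply/eqP; rewrite eq_le G_le1/= leNgt; apply/negP => Gs.
  have : (s%:E <= tG G)%E.
    by apply: ereal_sup_ubound; exists s => //; split=> //; exact/ltW/(lt_trans t0).
  by move=> /le_trans/(_ Gt); rewrite lee_fin leNgt ts.
have := @G_right_continuous t.
have : G x @[x --> t^'+] --> (1 : R).
  by apply: cvg_near_cst; near=> x; apply: H; near: x; exact: nbhs_right_gt.
by move=> /cvg_unique => U V; apply/esym/U.
Unshelve. all: by end_near. Qed.

Lemma Gext_tG : Gext G (tG G) = 1.
Proof.
case E : (tG G) tG_neqNy => [r| |]//= _.
by apply: G_ge_tG; rewrite E.
Qed.

Lemma dG_NyB (t : R) : dG G `]-oo, t]%classic = (G t)%:E.
Proof. by rewrite -cdf_lebesgue_stieltjes_id. Qed.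

Lemma dG_setT : dG G setT = 1%E.
Proof. exact: probability_setT. Qed.

Lemma dG_fin_num (A : set (measurableTypeR R)) : measurable A ->
  dG G A \is a fin_num.
Proof. exact: fin_num_measure. Qed.

Lemma dG_setD (A B : set (measurableTypeR R)) : measurable A -> measurable B ->
  B `<=` A -> dG G (A `\` B) = (dG G A - dG G B)%E.
Proof.
move=> mA mB BA; rewrite measureD ?setIidr//.
by have := dG_fin_num mA; rewrite fin_numElt => /andP[].
Qed.

Lemma dG_oc (a b : R) : a <= b -> dG G `]a, b]%classic = (G b - G a)%:E.
Proof.
move=> ab; rewrite itv_oc_setD dG_setD ?dG_NyB// => v /=.
by rewrite !in_itv/= => /le_trans; exact.
Qed.

(** The integral of the constant [1] over [(0, t]] is [G t]. *)
Lemma cvg_G_tG : G x @[x --> up_to (tG G)] --> fine (dG G (before (tG G))).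
Proof.
have := @Rintegral_cvg_up_to _ (dG G) (tG G) (cst 1) tG_neqNy.
have c1 : (dG G).-integrable (before (tG G)) (EFin \o cst 1).
  apply: finite_measure_integrable_cst; exact: measurable_before.
move=> /(_ c1); rewrite Rintegral_cst; last exact: measurable_before.
rewrite mul1r; apply: cvg_trans; apply: near_eq_cvg.
near=> x; rewrite Rintegral_cst//= mul1r.
have x0 : 0 <= x by apply/ltW; near: x; apply: up_to_gt; exact: tG_gt0.
by rewrite dG_oc//= G0 subr0.
Unshelve. all: by end_near. Qed.

Lemma jump_tGE : jump_tG G = 1 - fine (dG G (before (tG G))).
Proof. by rewrite /jump_tG Gext_tG (cvg_lim _ cvg_G_tG). Qed.

Lemma cvg_Gbar_tG : Gbar G x @[x --> up_to (tG G)] --> jump_tG G.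
Proof. by rewrite jump_tGE; apply: cvgB; [exact: cvg_cst|exact: cvg_G_tG]. Qed.

Lemma jump_tG_ge0 : 0 <= jump_tG G.
Proof.
rewrite jump_tGE subr_ge0 -lee_fin fineK; last first.
  by apply: dG_fin_num; exact: measurable_before.
by apply: probability_le1; exact: measurable_before.
Qed.

Lemma dG_oy (t : R) : dG G `]t, +oo[%classic = (Gbar G t)%:E.
Proof.
have -> : `]t, +oo[%classic = setT `\` `]-oo, t] :> set R.
  apply/seteqP; split=> v /=; rewrite !in_itv/= andbT.
    by move=> av; split=> //; apply/negP; rewrite -ltNge.
  by move=> [_ /negP]; rewrite -ltNge => ->.
by rewrite dG_setD// dG_setT dG_NyB.
Qed.

(** All the mass of [dG] outside [(0, tG)] is the atom at [tG]. *)
Lemma dG_from_tG :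
  dG G (`]0, +oo[ `\` before (tG G)) = (jump_tG G)%:E.
Proof.
rewrite dG_setD//; [|exact: measurable_before|]; last first.
  by move=> v [v0 _] /=; rewrite in_itv/= v0.
rewrite dG_oy /Gbar G0 subr0 jump_tGE EFinB fineK//.
by apply: dG_fin_num; exact: measurable_before.
Qed.

End distribution_function.

(** * Functions locally absolutely continuous with respect to G *)

Section locally_absolutely_continuous.
Context {R : realType} (G : cumulativeBounded (0 : R) (1 : R)).
Hypothesis G0 : G 0 = 0.
Variables F f : R -> R.
Hypothesis Ff : local_density G F f.
(* the left limit of F at v: the possible atom of dG at v is left out *)
Let Fminus (v : R) := F 0 + \int[dG G]_(u in before v%:E) f u.

Lemma density_integrable (t : R) : (t%:E < tG G)%E ->
  (dG G).-integrable `]0, t] (EFin \o f).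
Proof.
have [t0|t0] := ltP 0 t; first by move=> tT; have [] := Ff.2 t t0 tT.
by rewrite set_itv_ge -?leNgt// => _; exact: integrable_set0.
Qed.

Lemma density_integrable_before (t : R) : (t%:E < tG G)%E ->
  (dG G).-integrable (before t%:E) (EFin \o f).
Proof.
move=> tT; apply: integrableS (density_integrable tT) => //.
  exact: measurable_before.
by move=> v [v0]; rewrite lte_fin /= in_itv/= v0 => /ltW.
Qed.

Lemma F_integral (t : R) : 0 <= t -> (t%:E < tG G)%E ->
  F t = F 0 + \int[dG G]_(v in `]0, t]) f v.
Proof.
rewrite le_eqVlt => /predU1P[<-|t0] tT.
  by rewrite set_itv_ge ?bnd_simp ?ltxx// Rintegral_set0 addr0.
have [_ /(_ t)] := Ff.2 t t0 tT; rewrite t0 lexx => /(_ isT).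
by rewrite /Rintegral => <- /=; rewrite addrC subrK.
Qed.

Lemma F_right (t : R) : 0 <= t -> (t%:E < tG G)%E ->
  F u @[u --> t^'+] --> F t.
Proof.
move=> t0 tT; have [b [tb bT]] := lt_up_to_between tT.
rewrite (F_integral t0 tT).
have := Rintegral_cvg_right tb (density_integrable bT).
move=> /(cvgD (cvg_cst (F 0))); apply: cvg_trans; apply: near_eq_cvg.
near=> u => /=. rewrite !fctE. rewrite -F_integral//.
  by apply: le_trans t0 _; apply/ltW; near: u; exact: nbhs_right_gt.
apply: lt_trans bT; rewrite lte_fin; near: u; exact: nbhs_right_lt.
Unshelve. all: by end_near. Qed.

Lemma F_left (t : R) : 0 < t -> (t%:E < tG G)%E ->
  F u @[u --> t^'-] --> Fminus t.
Proof.
move=> t0 tT.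
have := @Rintegral_cvg_up_to _ (dG G) t%:E f isT (density_integrable_before tT).
move=> /(cvgD (cvg_cst (F 0))); apply: cvg_trans; apply: near_eq_cvg.
near=> u => /=. rewrite !fctE. rewrite -F_integral//.
  by apply/ltW; near: u; exact: nbhs_left_gt.
apply: lt_trans tT; rewrite lte_fin; near: u; exact: nbhs_left_lt.
Unshelve. all: by end_near. Qed.

Lemma AG_lt (v : R) : 0 < v -> (v%:E < tG G)%E ->
  AG G F f v = Fminus v - f v * Gbar G v.
Proof. by move=> v0 vT; rewrite /AG vT (cvg_lim _ (F_left v0 vT)). Qed.

(** Fubini's theorem for [f u * 1_(u < v <= t)]: integrating first in [u] gives the
    left side, integrating first in [v] gives the mass [G t - G u] of
    [(u, t]]. The density being integrable on [(0, t]] and [dG] finite, the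
    function is integrable on the product. *)
Lemma density_double_integral (t : R) : (t%:E < tG G)%E ->
  (dG G).-integrable `]0, t] (fun v => (\int[dG G]_(u in before v%:E) f u)%:E) /\
  (\int[dG G]_(v in `]0%R, t]) (\int[dG G]_(u in before v%:E) f u)%:E =
   \int[dG G]_(u in `]0%R, t]) (f u * (G t - G u))%:E)%E.
Proof.
move=> tT.
pose mu : {sigma_finite_measure set (measurableTypeR R) -> \bar R} :=
  lebesgue_stieltjes_measure G.
have fi := density_integrable tT.
pose fr := f \_ `]0, t].
have fri : mu.-integrable setT (EFin \o fr).
  by rewrite /fr -restrict_EFin; apply: (integrable_mkcond _ _).1.
(* v is the first coordinate, so that integrability of the inner integral in u
   is the statement about the first marginal in Fubini's theorem *)
pose k (z : measurableTypeR R * measurableTypeR R) :=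
  (if z.2 < z.1 then fr z.2 * \1_(`]0, t]%classic) z.1 else 0)%R.
have mfr : measurable_fun (setT : set (measurableTypeR R)) fr.
  by apply/measurable_EFinP; exact: measurable_int fri.
have mk : measurable_fun setT (EFin \o k).
  apply/measurable_EFinP; apply: measurable_fun_ifT => //.
  - exact: measurable_fun_ltr.
  - apply: measurable_funM; first exact: measurableT_comp.
    by apply: measurableT_comp => //; exact: measurable_indic.
have ki : (mu \x mu)%E.-integrable setT (EFin \o k).
  have gi : (mu \x mu)%E.-integrable setT (EFin \o (fr \o snd)).
    apply/integrable21ltyP; first by apply/measurable_EFinP; exact: measurableT_comp.
    have /integrableP[_] := fri; congr (_ < _)%E; apply: eq_integral => x _.
    transitivity (`|(fr x)%:E| * mu setT)%E; first by rewrite dG_setT mule1.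
    by rewrite -(integral_cst mu measurableT).
  apply: le_integrable gi => // z _ /=; rewrite lee_fin /k.
  case: ifP => _; last by rewrite normr0.
  by rewrite normrM indicE ler_piMr// normr_nat lern1 leq_b1.
have inner_u v : (\int[mu]_u (k (v, u))%:E)%E =
    ((fun v => (\int[dG G]_(u in before v%:E) f u)%:E) \_ `]0%R, t] v)%E.
  rewrite patchE; case: ifPn => [|/negP]; rewrite inE/= in_itv/=.
    move=> /andP[v0 vt].
    have vT : (v%:E < tG G)%E by apply: le_lt_trans tT; rewrite lee_fin.
    rewrite /Rintegral fineK; last first.
      apply: integrable_fin_num; first exact: measurable_before.
      exact: density_integrable_before.
    rewrite integral_mkcond; apply: eq_integral => u _.
    rewrite restrict_EFin /=; congr EFin.
    have vI : v \in `]0, t]%classic by rewrite inE/= in_itv/= v0.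
    rewrite /k/= /fr !patchE indicE vI mulr1.
    rewrite !mem_setE/= /before/= in_itv/=.
    case: ltP => uv; last first.
      by rewrite memNset// => -[_]; rewrite lte_fin ltNge uv.
    have [u0|u0] := boolP (0 < u).
      by rewrite !mem_set//= ?lte_fin// (le_trans (ltW uv)).
    by rewrite !memNset//= (negbTE u0)// => -[].
  move=> nv; rewrite integral0_eq// => u _.
  rewrite /k/=; case: ifP => // _; rewrite indicE (_ : _ \in _ = false) ?mulr0//.
  by apply/negbTE/negP; rewrite inE/= in_itv.
have inner_v u : (\int[mu]_v (k (v, u))%:E)%E =
    ((fun u => (f u * (G t - G u))%:E) \_ `]0%R, t] u)%E.
  rewrite patchE; case: ifPn => [|/negP]; rewrite inE/= in_itv/=.
    move=> /andP[u0 ut].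
    transitivity ((f u)%:E * \int[mu]_v (\1_(`]u, t]%classic) v)%:E)%E.
      rewrite -integralZl//; last exact: integrable_indic.
      apply: eq_integral => v _; rewrite -EFinM; congr EFin.
      rewrite /k/= /fr patchE mem_set/=; last by rewrite in_itv/= u0.
      rewrite !indicE !mem_setE/= !in_itv/=; case: ltP => uv /=; last by rewrite mulr0.
      by rewrite (lt_trans u0 uv).
    by rewrite integral_indic// setIT dG_oc.
  move=> nu; rewrite integral0_eq// => v _.
  by rewrite /k/= /fr patchE memNset/= ?mul0r ?if_same// ?in_itv.
have mI : measurable (`]0, t]%classic : set (measurableTypeR R)) by [].
split.
  apply: (integrable_mkcond _ mI).2.
  have := integrable_fubini_F ki; apply: eq_integrable => // v _.
  exact: inner_u.
rewrite integral_mkcond [RHS]integral_mkcond.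
have := Fubini ki; rewrite /=.
under eq_integral do rewrite inner_u.
by under [in X in _ = X -> _]eq_integral do rewrite inner_v.
Qed.

Lemma measurable_G : measurable_fun (setT : set (measurableTypeR R)) G.
Proof. by apply: nondecreasing_measurable => // x y; exact: G_nondecreasing. Qed.

Lemma density_Gbar_integrable (t : R) : (t%:E < tG G)%E ->
  (dG G).-integrable `]0, t] (EFin \o (fun v => f v * Gbar G v)).
Proof.
move=> tT; have fi := density_integrable tT.
apply: (le_integrable _ _ _ fi) => //.
  apply/measurable_EFinP; apply: measurable_funM.
    by apply/measurable_EFinP; exact: measurable_int fi.
  by apply: measurable_funB => //; apply: measurable_funTS; exact: measurable_G.
move=> v /=; rewrite in_itv/= => /andP[v0 _]; rewrite lee_fin normrM ler_piMr//.
have := G_ge0 G0 (ltW v0); have := G_le1 G v; rewrite /Gbar => G1 G_0.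
by rewrite ger0_norm ?subr_ge0// lerBlDr lerDl.
Qed.

(** Integration by parts for [F * Gbar]: the product has differential
    [- F(v-) dG + f Gbar dG = - AG dG]. Against the integral of [f * Gbar], the
    double integral of [f] leaves [- Gbar t] times the integral of [f], that is
    [- Gbar t * (F t - F 0)]. *)
Lemma AG_integral (t : R) : 0 <= t -> (t%:E < tG G)%E ->
  (dG G).-integrable `]0, t] (EFin \o AG G F f) /\
  \int[dG G]_(v in `]0, t]) AG G F f v = F 0 - F t * Gbar G t.
Proof.
move=> t0 tT.
have [Di DE] := density_double_integral tT.
have fi := density_integrable tT.
have fGi := density_Gbar_integrable tT.
have ci (c : R) : (dG G).-integrable `]0, t] (EFin \o cst c).
  exact: finite_measure_integrable_cst.
have FGi : (dG G).-integrable `]0, t] (EFin \o (fun v => Fminus v)).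
  have := integrableD _ (ci (F 0)) Di; apply => //.
have AE : {in `]0, t]%classic, AG G F f =1 (fun v => Fminus v - f v * Gbar G v)}.
  move=> v; rewrite inE/= in_itv/= => /andP[v0 vt].
  by rewrite AG_lt// (le_lt_trans _ tT)// lee_fin.
split.
  have hi : (dG G).-integrable `]0, t]
      (EFin \o (fun v => Fminus v - f v * Gbar G v)).
    by have := integrableB _ FGi fGi; apply.
  by apply: eq_integrable hi => // v /AE /= ->.
transitivity (\int[dG G]_(v in `]0, t]) (Fminus v - f v * Gbar G v)).
  exact: eq_Rintegral.
rewrite RintegralB// RintegralD//; last exact: ci.
rewrite Rintegral_cst//= dG_oc//= G0 subr0.
have -> : \int[dG G]_(v in `]0, t]) (\int[dG G]_(u in before v%:E) f u) =
    \int[dG G]_(u in `]0, t]) (f u * Gbar G u - f u * Gbar G t).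
  rewrite /Rintegral DE; congr fine; apply: eq_integral => u _; congr EFin.
  by rewrite /Gbar; ring.
rewrite RintegralB//; last exact: (integrableZr _ _ fi).
rewrite RintegralZr//.
have := F_integral t0 tT; rewrite /Gbar; set I := Rintegral _ _ _ => ->.
by set J := Rintegral _ _ _; ring.
Qed.

(** The value that [AG] takes everywhere on [[tG, +oo)]. *)
Definition AG_end : R :=
  if `[< cvg (F u @[u --> up_to (tG G)]) >] then
    lim (F u @[u --> up_to (tG G)]) * (0 < jump_tG G)%R%:R
  else 0.

Lemma AG_ge_tG (v : R) : (tG G <= v%:E)%E -> AG G F f v = AG_end.
Proof. by move=> Tv; rewrite /AG ltNge Tv. Qed.

(** Measurability is only available on the positive half-line, where [F] and its
    density are constrained; the extension by [0] can be composed with the jump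
    time. Below [tG] it follows from integrability on the intervals
    [(0, u n]]. *)
Lemma measurable_AG :
  measurable_fun (setT : set (measurableTypeR R)) (AG G F f \_ `]0, +oo[).
Proof.
have [u [u0 uT und ua]] := increasing_to (tG_gt0 G0).
have mB := measurable_before (tG G).
apply/(measurable_restrictT _ _).1 => //.
have -> : `]0, +oo[%classic = before (tG G) `|` (`]0, +oo[ `\` before (tG G)) :> set R.
  rewrite setDUK// => v [v0 _] /=; by rewrite in_itv/= v0.
apply/measurable_funU => //; first exact: measurableD.
split.
  have -> : before (tG G) = \bigcup_n `]0, u n]%classic.
    apply/seteqP; split=> v /=.
      move=> [v0 vT]; have [n _ /(_ n (leqnn _)) vn] := ua v vT.
      by exists n => //=; rewrite in_itv/= v0 ltW.
    move=> [n _] /=; rewrite in_itv/= => /andP[v0 vu]; split=> //.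
    by apply: le_lt_trans (uT n); rewrite lee_fin.
  apply/measurable_fun_bigcup => // n.
  have [hi _] := AG_integral (u0 n) (uT n).
  by apply/measurable_EFinP; exact: measurable_int hi.
apply: (eq_measurable_fun (cst AG_end)) => //.
move=> v; rewrite inE/= in_itv/= andbT => -[v0 nv].
rewrite AG_ge_tG// leNgt; apply/negP => vT; exact: nv.
Qed.

Lemma cvg_FGbar_tG : (dG G).-integrable (before (tG G)) (EFin \o AG G F f) ->
  F t * Gbar G t @[t --> up_to (tG G)] -->
    F 0 - \int[dG G]_(v in before (tG G)) AG G F f v.
Proof.
move=> Ai; have := Rintegral_cvg_up_to (tG_neqNy G0) Ai.
move=> /(cvgB (cvg_cst (F 0))); apply: cvg_trans; apply: near_eq_cvg.
near=> t.
have t0 : 0 <= t by apply/ltW; near: t; apply: up_to_gt; exact: tG_gt0.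
have tT : (t%:E < tG G)%E by near: t; apply: up_to_lt; exact: tG_neqNy.
by have [_ e] := AG_integral t0 tT; rewrite !fctE/= e opprB addrC subrK.
Unshelve. all: by end_near. Qed.

(** With an atom at [tG], [Gbar] stays away from [0] below [tG], so that [F] itself
    inherits a limit from [F * Gbar]. *)
Lemma cvg_F_tG : (dG G).-integrable (before (tG G)) (EFin \o AG G F f) ->
  0 < jump_tG G ->
  F t @[t --> up_to (tG G)] -->
    (F 0 - \int[dG G]_(v in before (tG G)) AG G F f v) / jump_tG G.
Proof.
move=> Ai j0; have FG := cvg_FGbar_tG Ai.
have := cvgM FG (cvgV (lt0r_neq0 j0) (cvg_Gbar_tG G0)).
move=> /(_ _ _) H; apply: cvg_trans H; apply: near_eq_cvg; near=> t.
have tT : (t%:E < tG G)%E by near: t; apply: up_to_lt; exact: tG_neqNy.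
by rewrite /= mulfK// gt_eqF// Gbar_gt0.
Unshelve. all: by end_near. Qed.

(** Without an atom at [tG], the integral is that over [(0, tG)], the limit of
    [F 0 - F t * Gbar t]. With an atom, the value of [AG] there is the left limit
    of [F], and its product with the mass of the atom compensates the limit of
    [F t * Gbar t]. *)
Lemma AG_integral_total : (dG G).-integrable `]0, +oo[ (EFin \o AG G F f) ->
  \int[dG G]_(v in `]0, +oo[) AG G F f v =
    F 0 - lim (F t * Gbar G t @[t --> up_to (tG G)]) * (jump_tG G == 0)%R%:R.
Proof.
move=> Ai; have mB := measurable_before (tG G).
have sB : before (tG G) `<=` `]0, +oo[ by move=> v [v0 _] /=; rewrite in_itv/= v0.
have Bi : (dG G).-integrable (before (tG G)) (EFin \o AG G F f).
  exact: integrableS Ai.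
rewrite (cvg_lim _ (cvg_FGbar_tG Bi))//.
have E : `]0, +oo[%classic = before (tG G) `|` (`]0, +oo[ `\` before (tG G)) :> set R.
  by rewrite setDUK.
rewrite {1}E Rintegral_setU//; last 3 first.
- exact: measurableD.
- by rewrite -E.
- by apply/disj_setPS => v [? []].
have -> : \int[dG G]_(v in `]0, +oo[ `\` before (tG G)) AG G F f v =
    AG_end * jump_tG G.
  have -> : \int[dG G]_(v in `]0, +oo[ `\` before (tG G)) AG G F f v =
     \int[dG G]_(v in `]0, +oo[ `\` before (tG G)) cst AG_end v.
    apply: eq_Rintegral => v; rewrite inE/= in_itv/= andbT => -[v0 nv].
    rewrite AG_ge_tG// leNgt; apply/negP => vT; exact: nv.
  by rewrite Rintegral_cst ?dG_from_tG//; exact: measurableD.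
set I := Rintegral _ _ _; have := jump_tG_ge0 G0.
rewrite le_eqVlt => /predU1P[<-|j0].
  by rewrite eqxx mulr0 mulr1; ring.
rewrite gt_eqF// mulr0 subr0 /AG_end j0 mulr1.
have Fc := cvg_F_tG Bi j0.
rewrite asboolT; last by apply/cvg_ex; eexists; exact: Fc.
by rewrite (cvg_lim _ Fc)// divfK ?gt_eqF// -/I addrC subrK.
Qed.

End locally_absolutely_continuous.

(** * Sigma-algebras generated by a single jump *)

Section sigma_algebra_closure.
Context {T : Type} (S : set (set T)) (sS : sigma_algebra setT S).

Lemma sigma_setC A : S A -> S (~` A).
Proof. by move=> SA; rewrite -setTD; have [_ + _] := sS; exact. Qed.

Lemma sigma_set0 : S set0.
Proof. by have [] := sS. Qed.

Lemma sigma_setT : S setT.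
Proof. by rewrite -setC0; exact/sigma_setC/sigma_set0. Qed.

Lemma sigma_setU A B : S A -> S B -> S (A `|` B).
Proof.
move=> SA SB; rewrite -bigcup2E; have [_ _] := sS; apply => n.
by rewrite /bigcup2; case: ifP => // _; case: ifP => // _; exact: sigma_set0.
Qed.

Lemma sigma_setI A B : S A -> S B -> S (A `&` B).
Proof.
by move=> SA SB; rewrite -[_ `&` _]setCK setCI; apply/sigma_setC/sigma_setU; exact: sigma_setC.
Qed.

End sigma_algebra_closure.

Section jump_filtration.
Context {d : measure_display} {Omega : measurableType d} {R : realType}.
Variables (P : probability Omega R) (gamma : {RV P >-> R}).
Hypothesis gamma_gt0 : forall w, 0 < gamma w.
Local Notation Fg := (Fgamma gamma).
Implicit Types (s t : \bar R) (A : set Omega) (B : set R).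

Lemma Fgamma_sigma t : sigma_algebra setT (Fg t).
Proof. exact: smallest_sigma_algebra. Qed.

Lemma Fgamma_mono s t : (s <= t)%E -> Fg s `<=` Fg t.
Proof.
move=> st; apply: smallest_sub; first exact: Fgamma_sigma.
move=> A [r [r0 rs ->]]; apply: sub_sigma_algebra.
by exists r; split => //; exact: le_trans st.
Qed.

Lemma measurable_gamma_le t : measurable [set w | ((gamma w)%:E <= t)%E].
Proof.
have mg : measurable_fun setT (EFin \o gamma) by exact/measurable_EFinP.
by rewrite -[X in measurable X]setTI; exact: emeasurable_fun_infty_c.
Qed.

Lemma measurable_gamma_lt t : measurable [set w | ((gamma w)%:E < t)%E].
Proof.
have mg : measurable_fun setT (EFin \o gamma) by exact/measurable_EFinP.
by rewrite -[X in measurable X]setTI; exact: emeasurable_fun_infty_o.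
Qed.

Lemma measurable_gamma_gt t : measurable [set w | (t < (gamma w)%:E)%E].
Proof.
rewrite (_ : [set _ | _] = ~` [set w | ((gamma w)%:E <= t)%E]).
  exact/measurableC/measurable_gamma_le.
by apply/seteqP; split=> w /=; rewrite ltNge => /negP.
Qed.

Lemma Fgamma_measurable t : Fg t `<=` measurable.
Proof.
apply: smallest_sub; first exact: sigma_algebra_measurable.
by move=> _ [r [_ _ ->]]; exact: measurable_gamma_le.
Qed.

Lemma Fgamma_le s t : (s <= t)%E -> Fg t [set w | ((gamma w)%:E <= s)%E].
Proof.
move=> st; have [s0|s0] := ltP 0%E s.
  by apply: sub_sigma_algebra; exists s.
rewrite (_ : [set _ | _] = set0); first exact: (sigma_set0 (Fgamma_sigma t)).
apply/seteqP; split=> w //= ws.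
by have := le_trans ws s0; rewrite lee_fin leNgt gamma_gt0.
Qed.

Lemma Fgamma_filtration : is_filtration (d := d) Fg.
Proof.
split=> [t _|s t _ st]; last exact: Fgamma_mono.
by split; [exact: Fgamma_sigma|exact: Fgamma_measurable].
Qed.

(** Until the jump nothing is revealed but its absence: the sets that do not cut
    [{t < gamma}] form a sigma-algebra, and the generators [{gamma <= s}] with
    [s <= t] are disjoint from [{t < gamma}]. *)
Lemma Fgamma_atom t A : Fg t A ->
  [set w | (t < (gamma w)%:E)%E] `<=` A \/ [set w | (t < (gamma w)%:E)%E] `<=` ~` A.
Proof.
pose at_ : set (set Omega) := [set A |
  [set w | (t < (gamma w)%:E)%E] `<=` A \/ [set w | (t < (gamma w)%:E)%E] `<=` ~` A].
suff : Fg t `<=` at_ by exact.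
apply: smallest_sub.
  split.
  - by right; rewrite setC0.
  - by move=> B [tB|tB]; [right|left]; rewrite setTD ?setCK.
  - move=> B tB; have [[k tk]|nk] := pselect (exists k, [set w | (t < (gamma w)%:E)%E] `<=` B k).
      by left => w /tk Bk; exists k.
    right => w tw [k _ Bk]; case: (tB k) => [tk|/(_ _ tw)//].
    by apply: nk; exists k.
move=> _ [s [_ st ->]]; right => w /= tw; apply/negP; rewrite -ltNge.
exact: le_lt_trans tw.
Qed.

(** From the jump on, its time is known exactly. The Borel sets [B] with this
    property form a sigma-algebra, because intersecting with [{gamma <= t}] turns
    complements into relative complements; for a half-open interval the event is
    a difference of two sets of the form [{gamma <= r}] with [r <= t]. *)
Lemma Fgamma_preimage t B : measurable B ->
  Fg t (gamma @^-1` B `&` [set w | ((gamma w)%:E <= t)%E]).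
Proof.
have St := Fgamma_sigma t.
have le_t : Fg t [set w | ((gamma w)%:E <= t)%E] by exact: Fgamma_le.
pose good : set (set R) := [set B |
  Fg t (gamma @^-1` B `&` [set w | ((gamma w)%:E <= t)%E])].
suff : (measurable : set (set R)) `<=` good by exact.
apply: smallest_sub.
  split.
  - by rewrite /good/= preimage_set0 set0I; exact: sigma_set0.
  - move=> C gC; rewrite /good/= setTD.
    rewrite (_ : _ `&` _ = ~` (gamma @^-1` C `&` [set w | ((gamma w)%:E <= t)%E])
        `&` [set w | ((gamma w)%:E <= t)%E]).
      by apply: (sigma_setI St) => //; exact: (sigma_setC St).
    by apply/seteqP; split=> w [/= h1 h2]; split=> // Cw; apply: h1; [case: Cw|split].
  - move=> C gC; rewrite /good/= preimage_bigcup setI_bigcupl.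
    by have [_ _ H] := St; apply: H => n; exact: gC.
move=> _ [[a b] _ <-]; rewrite /good/=.
rewrite (_ : _ `&` _ = [set w | ((gamma w)%:E <= Order.min b%:E t)%E] `&`
    ~` [set w | ((gamma w)%:E <= Order.min a%:E t)%E]).
  apply: (sigma_setI St); last apply: (sigma_setC St).
    by apply: Fgamma_le; rewrite ge_min lexx orbT.
  by apply: Fgamma_le; rewrite ge_min lexx orbT.
apply/seteqP; split=> w; rewrite /= in_itv/= !le_min !lee_fin.
  by move=> [/andP[aw wb] wt]; rewrite wb wt leNgt aw.
move=> [/andP[wb wt]]; rewrite wt andbT => /negP; rewrite -ltNge => aw.
by rewrite aw.
Qed.

Lemma Fgamma_measurable_wrt s (h : R -> R) (c : R) (Y : Omega -> R) :
  measurable_fun setT h ->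
  (forall w, (s < (gamma w)%:E)%E -> Y w = c) ->
  (forall w, ((gamma w)%:E <= s)%E -> Y w = h (gamma w)) ->
  measurable_wrt (Fg s) Y.
Proof.
move=> mh Yc Yh B mB; have Ss := Fgamma_sigma s.
have mhB : measurable (h @^-1` B) by rewrite -[X in measurable X]setTI; exact: mh.
have -> : Y @^-1` B = (gamma @^-1` (h @^-1` B) `&` [set w | ((gamma w)%:E <= s)%E]) `|`
   (~` [set w | ((gamma w)%:E <= s)%E] `&` (if c \in B then setT else set0)).
  apply/seteqP; split=> w /=.
    have [ws|sw] := leP (gamma w)%:E s; first by rewrite Yh//; left.
    by rewrite Yc// => cB; right; rewrite mem_set//; split=> //; apply/negP; rewrite -ltNge.
  move=> [[hB ws]|[/negP]]; first by rewrite Yh.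
  by rewrite -ltNge => sw; rewrite Yc//; case: ifPn => //; rewrite inE.
apply: (sigma_setU Ss); first exact: Fgamma_preimage.
apply: (sigma_setI Ss); first by apply: (sigma_setC Ss); exact: Fgamma_le.
by case: ifP => _; [exact: sigma_setT|exact: sigma_set0].
Qed.

(** On an event disjoint from [{s < gamma}] the two variables coincide. By
    [Fgamma_atom] the other events contain [{s < gamma}], so that their
    complements are of the former kind, and equality of the means transfers the
    identity from the complement to the event. *)
Lemma cond_exp_after_jump s (Z Y : Omega -> R) :
  measurable_wrt (Fg s) Y ->
  P.-integrable setT (EFin \o Z) -> P.-integrable setT (EFin \o Y) ->
  (forall w, ((gamma w)%:E <= s)%E -> Y w = Z w) ->
  (\int[P]_w (Y w)%:E = \int[P]_w (Z w)%:E)%E ->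
  is_cond_exp P (Fg s) Z Y.
Proof.
move=> mY Zi Yi YZ EYZ; split=> // A FA.
have mA : measurable A by exact: Fgamma_measurable FA.
have eqI C : [set w | (s < (gamma w)%:E)%E] `<=` ~` C ->
    (\int[P]_(w in C) (Y w)%:E = \int[P]_(w in C) (Z w)%:E)%E.
  move=> sC; apply: eq_integral => w; rewrite inE => Cw; congr EFin; apply: YZ.
  by rewrite leNgt; apply/negP => /sC.
have splitA (V : Omega -> R) : P.-integrable setT (EFin \o V) ->
    (\int[P]_w (V w)%:E = \int[P]_(w in A) (V w)%:E + \int[P]_(w in ~` A) (V w)%:E)%E.
  move=> Vi; rewrite -integral_setU ?setUv//; first exact: measurableC.
    exact: measurable_int Vi.
  by apply/disj_setPS; rewrite setICr.
have [sA|/eqI//] := Fgamma_atom FA.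
have := EYZ; rewrite splitA// [RHS]splitA// (eqI (~` A)) ?setCK//.
have fin : (\int[P]_(w in ~` A) (Z w)%:E)%E \is a fin_num.
  apply: integrable_fin_num; first exact: measurableC.
  by apply: integrableS Zi => //; exact: measurableC.
by move=> /(congr1 (fun x => x - \int[P]_(w in ~` A) (Z w)%:E)%E); rewrite !addeK.
Qed.

End jump_filtration.

(** * The jump time and its law *)

Section single_jump_process.
Context {d : measure_display} {Omega : measurableType d} {R : realType}.
Variables (P : probability Omega R) (gamma : {RV P >-> R}).
Variable G : cumulativeBounded (0 : R) (1 : R).
Hypothesis G0 : G 0 = 0.
Hypothesis gamma_gt0 : forall w, 0 < gamma w.
Hypothesis gamma_cdf : forall t : R, cdf gamma t = (G t)%:E.

(* R and measurableTypeR R have the same measurable sets but different displays;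
   dG is a measure on the latter *)
Let gamma' : Omega -> measurableTypeR R := gamma.

Let mgamma' : measurable_fun setT gamma'.
Proof. exact: (measurable_funP gamma). Qed.

#[local] HB.instance Definition _ :=
  @isMeasurableFun.Build _ _ _ (measurableTypeR R) gamma' mgamma'.

(** Both measures give the mass [G b - G a] to [(a, b]]. *)
Lemma law_gamma (A : set R) : measurable A -> dG G A = P (gamma @^-1` A).
Proof.
move=> mA; apply: (@lebesgue_stieltjes_measure_unique _ G (distribution P gamma')) mA.
move=> _ [[a b] _ <-] /=.
have [ab|ba] := leP a b; last first.
  by rewrite set_itv_ge ?measure0// bnd_simp -leNgt ltW.
rewrite [LHS]dG_oc// itv_oc_setD measureD//; last by rewrite [ltLHS]gamma_cdf ltry.
rewrite setIidr; last by move=> v /=; rewrite !in_itv/= => /le_trans; exact.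
by rewrite EFinB -!gamma_cdf.
Qed.

Lemma law_integrable (D : set R) (h : R -> R) : measurable D ->
  measurable_fun setT h ->
  (dG G).-integrable D (EFin \o h) <->
  P.-integrable (gamma @^-1` D) (EFin \o (h \o gamma)).
Proof.
move=> mD mh.
have mgD : measurable (gamma @^-1` D).
  by rewrite -[X in measurable X]setTI; exact: measurable_funP.
have mh' : measurable_fun setT (EFin \o h) by exact/measurable_EFinP.
have E : (\int[dG G]_(v in D) `|(h v)%:E| =
    \int[P]_(w in gamma @^-1` D) `|(h (gamma w))%:E|)%E.
  rewrite (@eq_measure_integral _ _ _ _ (distribution P gamma')); last first.
    by move=> A mA _; exact: law_gamma.
  by rewrite ge0_integral_pushforward//; apply: measurableT_comp => //; exact: measurable_funTS.
split=> /integrableP[_ fin]; apply/integrableP; split.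
- by apply/measurable_EFinP; apply: measurable_funTS; exact: measurableT_comp.
- by rewrite -E.
- exact: measurable_funTS.
- by rewrite E.
Qed.

Lemma law_integral (D : set R) (h : R -> R) : measurable D ->
  measurable_fun setT h ->
  P.-integrable (gamma @^-1` D) (EFin \o (h \o gamma)) ->
  (\int[dG G]_(v in D) (h v)%:E = \int[P]_(w in gamma @^-1` D) (h (gamma w))%:E)%E.
Proof.
move=> mD mh hi.
rewrite (@eq_measure_integral _ _ _ _ (distribution P gamma')); last first.
  by move=> A mA _; exact: law_gamma.
by rewrite integral_pushforward//; exact/measurable_EFinP.
Qed.

(** * Means and conditional expectations of the process *)

Variables F dF : R -> R.
Hypothesis hdF : local_density G F dF.
Local Notation M := (MG gamma G F dF).
Local Notation Z := (AG G F dF \_ `]0, +oo[).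
Implicit Types (s t U : \bar R) (w : Omega).

Lemma Z_gamma w : Z (gamma w) = AG G F dF (gamma w).
Proof. by rewrite patchE mem_set//= in_itv/= gamma_gt0. Qed.

Lemma MG_before t w : (t < (gamma w)%:E)%E -> M t w = F (fine t).
Proof. by move=> tw; rewrite /MG tw leNgt tw mulr1 mulr0 addr0. Qed.

Lemma MG_after t w : ((gamma w)%:E <= t)%E -> M t w = AG G F dF (gamma w).
Proof. by move=> wt; rewrite /MG wt ltNge wt mulr1 mulr0 add0r. Qed.

Lemma MG_0 w : M 0%E w = F 0.
Proof. by rewrite MG_before// lte_fin. Qed.

Lemma MG_adapted t : measurable_wrt (Fgamma gamma t) (M t).
Proof.
apply: (Fgamma_measurable_wrt gamma_gt0 (measurable_AG G0 hdF)).
  by move=> w; exact: MG_before.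
by move=> w wt; rewrite MG_after// Z_gamma.
Qed.

(** The event [{t < gamma}] contributes [F t * Gbar t] and, by [AG_integral], the
    event [{gamma <= t}] contributes [F 0 - F t * Gbar t]. *)
Lemma integral_MG_lt (t : R) : 0 <= t -> (t%:E < tG G)%E ->
  P.-integrable setT (EFin \o M t%:E) ->
  (\int[P]_w (M t%:E w)%:E = (F 0)%:E)%E.
Proof.
move=> t0 tT Mi.
have mI : measurable (`]0, t]%classic : set R) by [].
have mJ : measurable (`]t, +oo[%classic : set R) by [].
have mpre (D : set R) : measurable D -> measurable (gamma @^-1` D).
  by move=> mD; rewrite -[X in measurable X]setTI; exact: measurable_funP.
have E : setT = gamma @^-1` `]0, t] `|` gamma @^-1` `]t, +oo[.
  apply/seteqP; split=> w //= _; rewrite !in_itv/= gamma_gt0 andbT/=.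
  by case: leP => _; [left|right].
rewrite {1}E integral_setU//; last 4 first.
- exact: mpre.
- exact: mpre.
- by rewrite -E; exact: measurable_int Mi.
- apply/disj_setPS => w /=; rewrite !in_itv/= andbT gamma_gt0/= => -[wt].
  by rewrite ltNge wt.
have mZ := measurable_AG G0 hdF.
have ZA : {in `]0, t]%classic, AG G F dF =1 Z}.
  by move=> v; rewrite inE/= in_itv/= => /andP[v0 _]; rewrite patchE mem_set//= in_itv/= v0.
have [Ai AE] := AG_integral G0 hdF t0 tT.
have Zi : (dG G).-integrable `]0, t] (EFin \o Z).
  by apply: eq_integrable Ai => // v /ZA /= ->.
have -> : (\int[P]_(w in gamma @^-1` `]0%R, t]) (M t%:E w)%:E = (F 0 - F t * Gbar G t)%:E)%E.
  transitivity (\int[P]_(w in gamma @^-1` `]0%R, t]) (Z (gamma w))%:E)%E.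
    apply: eq_integral => w; rewrite inE/= in_itv/= => /andP[_ wt].
    by rewrite MG_after// Z_gamma.
  rewrite -law_integral//; last exact: (law_integrable _ _).1.
  rewrite -AE /Rintegral fineK; last exact: integrable_fin_num.
  by apply: eq_integral => v /ZA ->.
have -> : (\int[P]_(w in gamma @^-1` `]t, +oo[) (M t%:E w)%:E = (F t * Gbar G t)%:E)%E.
  transitivity (\int[P]_(w in gamma @^-1` `]t, +oo[) (cst (F t)%:E w))%E.
    apply: eq_integral => w; rewrite inE/= in_itv/= andbT => tw.
    by rewrite MG_before.
  rewrite integral_cst//; last exact: mpre.
  by rewrite EFinM -dG_oy law_gamma.
by rewrite -EFinD subrK.
Qed.

Lemma gamma_after_tG : P [set w | (tG G < (gamma w)%:E)%E] = 0%E.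
Proof.
case E : (tG G) (tG_neqNy G0) => [r| |]// _; last first.
  rewrite (_ : [set _ | _] = set0) ?measure0//.
  by apply/seteqP; split=> w //=; rewrite ltNge leey.
transitivity (dG G `]r, +oo[%classic).
  rewrite law_gamma//; congr (P _); apply/seteqP; split=> w /=.
    by rewrite in_itv/= andbT lte_fin.
  by rewrite in_itv/= andbT lte_fin.
by rewrite dG_oy /Gbar (G_ge_tG G0) ?E// subrr.
Qed.

(** Almost surely [gamma <= tG], hence [M tG = AG gamma], whose mean is an integral
    against [dG]; integrability of [M tG] thus gives that of [AG]. *)
Lemma integral_MG_tG : P.-integrable setT (EFin \o M (tG G)) ->
  (dG G).-integrable `]0, +oo[ (EFin \o AG G F dF) /\
  (\int[P]_w (M (tG G) w)%:E =
   (F 0 - lim (F t * Gbar G t @[t --> up_to (tG G)]) * (jump_tG G == 0)%R%:R)%:E)%E.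
Proof.
move=> Mi.
have mI : measurable (`]0%R, +oo[%classic : set R) by [].
have mN := measurable_gamma_gt gamma (tG G).
have mZ := measurable_AG G0 hdF.
have MZ : {in setT `\` [set w | (tG G < (gamma w)%:E)%E],
    (EFin \o M (tG G)) =1 (EFin \o (Z \o gamma))}.
  move=> w; rewrite inE => -[_ /= /negP]; rewrite -leNgt => wT.
  by rewrite MG_after// Z_gamma.
have mZg : measurable_fun setT (EFin \o (Z \o gamma)).
  by apply/measurable_EFinP; exact: measurableT_comp.
have ZgiN : P.-integrable (setT `\` [set w | (tG G < (gamma w)%:E)%E])
    (EFin \o (Z \o gamma)).
  have := (negligible_integrable mN measurableT (measurable_int _ Mi) gamma_after_tG).1 Mi.
  by apply: eq_integrable => //; exact: measurableD.
have Zgi : P.-integrable setT (EFin \o (Z \o gamma)).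
  exact: (negligible_integrable mN measurableT mZg gamma_after_tG).2.
have Zgi' : P.-integrable (gamma @^-1` setT) (EFin \o (Z \o gamma)).
  by rewrite preimage_setT.
have Zi : (dG G).-integrable setT (EFin \o Z) by apply/(law_integrable measurableT mZ).
have Ai : (dG G).-integrable `]0, +oo[ (EFin \o AG G F dF).
  by apply: (integrable_mkcond _ _).2 => //; rewrite restrict_EFin.
split=> //.
rewrite (negligible_integral mN measurableT Mi gamma_after_tG).
rewrite (eq_integral _ _ MZ) -(negligible_integral mN measurableT Zgi gamma_after_tG).
rewrite -[in LHS](preimage_setT gamma) -law_integral// -(AG_integral_total G0 hdF Ai).
rewrite /Rintegral fineK; last exact: integrable_fin_num.
by rewrite [RHS]integral_mkcond restrict_EFin.
Qed.

Hypothesis hM : integrable_on P (tG G) M.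
Let dmu : R := fine 'E_P[M (tG G)] - fine 'E_P[M 0%E].

Lemma integral_MG t : (0 <= t)%E -> (t <= tG G)%E ->
  (\int[P]_w (M t w)%:E = (F 0 + (if t == tG G then dmu else 0))%:E)%E.
Proof.
move=> t0; rewrite le_eqVlt; case: eqVneq => [-> _|_ /= tT].
  have E0 : ('E_P[M 0%E] = (F 0)%:E)%E.
    rewrite unlock; apply: integral_MG_lt => //; first exact: tG_gt0.
    by apply: hM => //; exact/ltW/tG_gt0.
  rewrite /dmu E0 unlock /= addrC subrK fineK//; apply: integrable_fin_num => //.
  by apply: hM => //; exact/ltW/tG_gt0.
have tr : t \is a fin_num by rewrite ge0_fin_numE// (lt_le_trans tT)// leey.
rewrite addr0 -(fineK tr) integral_MG_lt ?fine_ge0 ?fineK//.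
by apply: hM => //; exact: ltW.
Qed.

Lemma gamma_gt s : (0 <= s)%E -> (s < tG G)%E ->
  P [set w | (s < (gamma w)%:E)%E] = (Gbar G (fine s))%:E.
Proof.
move=> s0 sT.
have sr : s \is a fin_num by rewrite ge0_fin_numE// (lt_le_trans sT)// leey.
rewrite -dG_oy law_gamma//; congr (P _); apply/seteqP; split=> w /=.
  by rewrite in_itv/= andbT -lte_fin fineK.
by rewrite in_itv/= andbT -lte_fin fineK.
Qed.

(** The correction is constant on [{s < gamma}], the only part of the space where
    [M s] and [M t] may differ; dividing by [P (s < gamma) = Gbar s] gives it the
    mean [E[M t] - E[M s]]. For [s = tG] this probability may vanish, but then
    [t = s] and no correction is called for. *)
Lemma MG_cond_exp s t : (0 <= s)%E -> (s <= t)%E -> (t <= tG G)%E ->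
  is_cond_exp P (Fgamma gamma s) (M t)
    (fun w => M s w + (if (t == tG G) && (s != tG G) then dmu else 0)
       / Gbar G (fine s) * (s < (gamma w)%:E)%E%:R).
Proof.
move=> s0 st tT; set c := (X in X / _).
have sT := le_trans st tT; have t0 := le_trans s0 st.
pose S : set Omega := [set w | (s < (gamma w)%:E)%E].
have mS : measurable S by exact: measurable_gamma_gt.
have Si : P.-integrable setT (EFin \o (fun w => c / Gbar G (fine s) * \1_S w)).
  have := integrableZl measurableT (c / Gbar G (fine s)) (integrable_indic P mS).
  exact.
have SE w : \1_S w = (s < (gamma w)%:E)%E%:R :> R.
  by rewrite indicE; congr (nat_of_bool _)%:R; apply/idP/idP; rewrite inE.
under [X in is_cond_exp _ _ _ X]eq_fun do rewrite -SE.
have Msi : P.-integrable setT (EFin \o M s) by exact: hM.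
apply: cond_exp_after_jump => //.
- apply: (Fgamma_measurable_wrt gamma_gt0 (measurable_AG G0 hdF)).
    by move=> w sw; rewrite MG_before// SE sw.
  by move=> w ws; rewrite MG_after// SE ltNge ws mulr0 addr0 Z_gamma.
- exact: hM.
- by have := integrableD measurableT Msi Si; apply.
- by move=> w ws; rewrite SE ltNge ws mulr0 addr0 !MG_after// (le_trans ws).
transitivity (\int[P]_w (M s w)%:E + \int[P]_w (c / Gbar G (fine s) * \1_S w)%:E)%E.
  by rewrite -integralD.
have -> : (\int[P]_w (c / Gbar G (fine s) * \1_S w)%:E = c%:E)%E.
  under eq_integral do rewrite EFinM.
  rewrite integralZl ?integral_indic ?setIT//; last exact: integrable_indic.
  have [sE|sN] := eqVneq s (tG G); first by rewrite /c sE eqxx andbF mul0r mul0e.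
  have sT' : (s < tG G)%E by rewrite lt_neqAle sN.
  rewrite [X in (_ * X)%E]gamma_gt// -EFinM divfK// gt_eqF// Gbar_gt0 ?fineK//.
  by rewrite ge0_fin_numE// (lt_le_trans sT')// leey.
rewrite !integral_MG// -EFinD; congr EFin; rewrite /c.
have [sE|sN] := eqVneq s (tG G).
  have -> : t = s by apply/eqP; rewrite eq_le st sE tT.
  by rewrite sE eqxx andbF addr0.
by rewrite andbT addr0.
Qed.

(** Before [tG] all the means are [F 0], so a constant stopping time below [tG]
    leaves no defect; stopping at [tG] itself is harmless only if [dmu = 0]. *)
Lemma MG_stopped_cond_exp U s t : (0 <= U)%E -> (U <= tG G)%E ->
  (U = tG G -> dmu = 0) ->
  (0 <= s)%E -> (s <= t)%E -> (t <= tG G)%E ->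
  is_cond_exp P (Fgamma gamma s) (M (Order.min t U)) (M (Order.min s U)).
Proof.
move=> U0 UT dU s0 st tT.
have m0 r : (0 <= r)%E -> (0 <= Order.min r U)%E by move=> r0; rewrite le_min r0.
have mT r : (Order.min r U <= tG G)%E by rewrite ge_min UT orbT.
have t0 := le_trans s0 st.
apply: cond_exp_after_jump => //; [|by apply: hM; [exact: m0|exact: mT]|by apply: hM; [exact: m0|exact: mT]| |].
- move=> B mB; apply: (@Fgamma_mono _ _ _ _ _ (Order.min s U)); last exact: MG_adapted.
  by rewrite ge_min lexx.
- move=> w ws; have [Us|sU] := leP U s; first by rewrite min_r// (le_trans Us).
  by rewrite !MG_after// le_min (le_trans ws)//= (le_trans ws)// ltW.
have meq r : (0 <= r)%E -> (if Order.min r U == tG G then dmu else 0) = 0.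
  move=> r0; case: eqP => // E; apply: dU; apply/eqP; rewrite eq_le UT -E.
  by rewrite ge_min lexx orbT.
by rewrite !integral_MG// ?m0// !meq.
Qed.

Lemma AG_integrable : (dG G).-integrable `]0, +oo[ (EFin \o AG G F dF).
Proof.
by have [] := integral_MG_tG (hM (ltW (tG_gt0 G0)) (lexx _)).
Qed.

Lemma AG_integrable_before : (dG G).-integrable (before (tG G)) (EFin \o AG G F dF).
Proof.
apply: integrableS AG_integrable => //; first exact: measurable_before.
by move=> v [v0 _] /=; rewrite in_itv/= v0.
Qed.

Lemma dmuE : dmu = - (lim (F t * Gbar G t @[t --> up_to (tG G)])
  * (jump_tG G == 0)%R%:R).
Proof.
have T0 := ltW (tG_gt0 G0).
have [_] := integral_MG_tG (hM T0 (lexx _)).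
rewrite integral_MG// eqxx => -[]; lra.
Qed.

(** * Regularity of the paths *)

Lemma gamma_lt_tG : jump_tG G = 0 -> P [set w | ((gamma w)%:E < tG G)%E] = 1%E.
Proof.
move=> j0; transitivity (dG G (before (tG G))).
  rewrite law_gamma//; last exact: measurable_before.
  congr (P _); apply/seteqP; split=> w /=; first by split.
  by case.
have := jump_tGE G0; rewrite j0 => /esym/eqP; rewrite subr_eq0 => /eqP e.
rewrite -[LHS]fineK -?e//; apply: dG_fin_num; exact: measurable_before.
Qed.

(** If [dG] has no atom at [tG], the jump occurs before [tG]; if it has one, [F] has
    a left limit at [tG]. Either way the path has a left limit there. *)
Lemma ae_path_before_tG : {ae P, forall w, ((gamma w)%:E < tG G)%E \/
  cvg (F u @[u --> up_to (tG G)])}.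
Proof.
have := jump_tG_ge0 G0; rewrite le_eqVlt => /predU1P[/esym j0|j0]; last first.
  apply: aeW => w; right; apply/cvg_ex; eexists.
  exact: (cvg_F_tG G0 hdF AG_integrable_before j0).
have mS := measurable_gamma_lt gamma (tG G).
exists (~` [set w | ((gamma w)%:E < tG G)%E]); split; first exact: measurableC.
  by rewrite probability_setC// gamma_lt_tG// subee.
by move=> w /= nw wT; apply: nw; left.
Qed.

Lemma MG_cadlag w :
  ((gamma w)%:E < tG G)%E \/ cvg (F u @[u --> up_to (tG G)]) ->
  cadlag_on (tG G) (M ^~ w).
Proof.
move=> good; split=> [t t0 tT|t t0 tT].
  have [tw|wt] := ltP t (gamma w).
    rewrite MG_before ?lte_fin//.
    have := F_right hdF t0 tT; apply: cvg_trans; apply: near_eq_cvg.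
    by near=> u; rewrite MG_before// lte_fin; near: u; exact: nbhs_right_lt.
  rewrite MG_after ?lee_fin//; apply: cvg_near_cst; near=> u.
  rewrite MG_after// lee_fin (le_trans wt)// ltW//; near: u; exact: nbhs_right_gt.
have tN : t != -oo%E by rewrite gt_eqF// (lt_trans _ t0)// ltNyr.
have [tw|wt] := leP t (gamma w)%:E; last first.
  apply/cvg_ex; exists (AG G F dF (gamma w)); apply: cvg_near_cst; near=> u.
  by rewrite MG_after// lee_fin ltW//; near: u; exact: up_to_gt.
have cF : cvg (F u @[u --> up_to t]).
  have [tE|tN'] := eqVneq t (tG G).
    by rewrite tE; case: good => //; rewrite -tE ltNge tw.
  have tT' : (t < tG G)%E by rewrite lt_neqAle tN'.
  case: t t0 tT tT' {tN tw tN'} => [r| |]//; last by move=> _ _; rewrite ltNge leey.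
  move=> r0 _ rT; apply/cvg_ex; eexists; exact: (F_left hdF).
move: cF => /cvg_ex[l Fl]; apply/cvg_ex; exists l.
apply: cvg_trans Fl; apply: near_eq_cvg; near=> u.
rewrite MG_before//; apply: lt_le_trans tw; near: u; exact: up_to_lt.
Unshelve. all: by end_near. Qed.

(** * Stopping and localization *)

Local Notation FM := (generated_filtration M).

Lemma FM_sub_Fgamma : subfiltration FM (Fgamma gamma).
Proof.
move=> t _; apply: smallest_sub; first exact: Fgamma_sigma.
move=> _ [s [_ st [B mB ->]]]; apply: (Fgamma_mono st); exact: MG_adapted.
Qed.

Lemma FM_filtration : is_filtration (d := d) FM.
Proof.
split=> [t t0|s t s0 st].
  split; first exact: smallest_sigma_algebra.
  exact: subset_trans (FM_sub_Fgamma t0) (@Fgamma_measurable _ _ _ _ _ _).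
apply: smallest_sub; first exact: smallest_sigma_algebra.
move=> A [r [r0 rs AE]]; apply: sub_sigma_algebra; exists r; split=> //.
exact: le_trans st.
Qed.

(** By [MG_cond_exp] the drift is always a nonnegative multiple of [dmu]; this
    covers martingales, submartingales and supermartingales at once. *)
Lemma MG_rel_martingale (rel : R -> R -> Prop) :
  (forall x r, 0 <= r -> rel (x + dmu * r) x) ->
  rel_martingale_on P rel (tG G) (Fgamma gamma) M.
Proof.
move=> hrel; split.
- exact: Fgamma_filtration.
- by apply: filterS ae_path_before_tG => w; exact: MG_cadlag.
- by move=> t _ _; exact: MG_adapted.
- exact: hM.
move=> s t s0 st tT; have ce := MG_cond_exp s0 st tT; eexists; first exact: ce.
apply: aeW => w /=.
case: ifP => [/andP[_ sN]|_]; last by rewrite mul0r mul0r -(mulr0 dmu); exact: hrel.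
rewrite -mulrA; apply: hrel; rewrite mulr_ge0// invr_ge0 ltW//.
have sT : (s < tG G)%E by rewrite lt_neqAle sN (le_trans st).
by rewrite Gbar_gt0// fineK// ge0_fin_numE// (lt_le_trans sT)// leey.
Qed.

Lemma MG_stopped_martingale U : (0 <= U)%E -> (U <= tG G)%E ->
  (U = tG G -> dmu = 0) ->
  martingale_on P (tG G) (Fgamma gamma) (stopped M (cst U)).
Proof.
move=> U0 UT dU; rewrite /stopped/=; split.
- exact: Fgamma_filtration.
- apply: filterS ae_path_before_tG => w good.
  exact: cadlag_on_min UT (MG_cadlag good).
- move=> t _ _ B mB; apply: (@Fgamma_mono _ _ _ _ _ (Order.min t U)); last exact: MG_adapted.
  by rewrite ge_min lexx.
- by move=> t t0 tT; apply: hM; rewrite ?le_min ?t0// ge_min tT.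
move=> s t s0 st tT; exists (M (Order.min s U)); first exact: MG_stopped_cond_exp.
exact: aeW.
Qed.

Section localization.
Variable u : R^nat.
Hypotheses (u0 : forall n, 0 <= u n) (uT : forall n, ((u n)%:E < tG G)%E)
  (und : nondecreasing_seq u)
  (ua : forall a, (a%:E < tG G)%E -> \forall n \near \oo, a < u n).

(** [agree n w] holds when the values of the path at [u 0, ..., u n] do not
    contradict that the jump is still to come. Unlike the event
    [{u n < gamma}], this is observable from the process [M] alone. *)
Fixpoint agree (n : nat) (w : Omega) : bool :=
  (M (u n)%:E w == F (u n)) && (if n is m.+1 then agree m w else true).

Definition loc_time (n : nat) (w : Omega) : \bar R :=
  if agree n w then (u n)%:E else tG G.

Lemma agree_before n w : u n < gamma w -> agree n w.
Proof.
elim: n => [|n ih] uw /=; rewrite MG_before ?lte_fin// eqxx//=.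
by apply: ih; apply: le_lt_trans uw; exact: und.
Qed.

Lemma agree_measurable n : FM (u n)%:E [set w | agree n w].
Proof.
have gen k : (k <= n)%N -> FM (u n)%:E [set w | M (u k)%:E w == F (u k)].
  move=> kn; apply: sub_sigma_algebra; exists (u k)%:E; split; rewrite ?lee_fin//.
    exact: und.
  exists [set F (u k)]; first exact: measurable_set1.
  by apply/seteqP; split=> w /= /eqP.
have Sn : sigma_algebra setT (FM (u n)%:E) by exact: smallest_sigma_algebra.
suff H k : (k <= n)%N -> FM (u n)%:E [set w | agree k w] by exact: H.
elim: k => [|k ih] kn.
  rewrite (_ : [set _ | _] = [set w | M (u 0%N)%:E w == F (u 0%N)]); first exact: gen.
  by apply/seteqP; split=> w /=; rewrite andbT.
rewrite (_ : [set _ | _] =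
  [set w | M (u k.+1)%:E w == F (u k.+1)] `&` [set w | agree k w]).
  by apply: (sigma_setI Sn); [exact: gen|apply: ih; exact: ltnW].
by apply/seteqP; split=> w /= => [/andP[]//|[-> ->]].
Qed.

Lemma loc_stopping_time n : stopping_time FM (tG G) (loc_time n).
Proof.
split=> [w|t t0].
  by rewrite /loc_time; case: ifP => _; rewrite ?lexx ?lee_fin ?u0 ltW// tG_gt0.
have St : sigma_algebra setT (FM t) by exact: smallest_sigma_algebra.
have [Tt|tT] := leP (tG G) t.
  rewrite (_ : [set _ | _] = setT); first exact: (sigma_setT St).
  apply/seteqP; split=> w //= _; rewrite /loc_time; case: ifP => // _.
  exact/ltW/(lt_le_trans _ Tt).
have [ut|tu] := leP (u n)%:E t.
  rewrite (_ : [set _ | _] = [set w | agree n w]).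
    have [_ mono] := FM_filtration.
    by apply: (mono (u n)%:E t _ ut); [rewrite lee_fin|exact: agree_measurable].
  apply/seteqP; split=> w /=; rewrite /loc_time; case: ifP => //.
  by move=> _; rewrite leNgt tT.
rewrite (_ : [set _ | _] = set0); first exact: (sigma_set0 St).
by apply/seteqP; split=> w //=; rewrite /loc_time; case: ifP => _; rewrite leNgt ?tu ?tT.
Qed.

Lemma loc_time_nondecreasing n w : (loc_time n w <= loc_time n.+1 w)%E.
Proof.
rewrite /loc_time; have [a1|_] := boolP (agree n.+1 w).
  have -> : agree n w by move: a1 => /= /andP[].
  by rewrite lee_fin; exact: und.
by case: ifP => _; rewrite ?lexx// ltW.
Qed.

(** The two times differ only when [agree n] fails, that is after a jump before
    [u n], when the path is already constant. *)
Lemma stopped_loc_time n : stopped M (loc_time n) = stopped M (cst (u n)%:E).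
Proof.
apply/funext => t; apply/funext => w; rewrite /stopped/= /loc_time.
case: ifPn => // na.
have wu : ((gamma w)%:E <= (u n)%:E)%E.
  by rewrite lee_fin leNgt; apply: contra na; exact: agree_before.
have [tu|ut] := leP t (u n)%:E; first by rewrite min_l// (le_trans tu)// ltW.
rewrite !MG_after// le_min (le_trans wu (ltW ut))/=.
by rewrite (le_trans wu)// ltW.
Qed.

(** The events [{loc_time n = tG}] increase, and they exhaust [{gamma < tG}], which
    has probability one as [dG] has no atom at [tG]. *)
Lemma loc_time_cvg : dmu != 0 -> P [set w | loc_time n w = tG G] @[n --> \oo] --> 1%E.
Proof.
move=> d0.
have [j0 L0] : jump_tG G = 0 /\ lim (F t * Gbar G t @[t --> up_to (tG G)]) != 0.
  move: d0; rewrite dmuE oppr_eq0 mulf_eq0 negb_or => /andP[-> ].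
  by rewrite pnatr_eq0 eqb0 negbK => /eqP ->.
have loc_timeE n : [set w | loc_time n w = tG G] = ~` [set w | agree n w].
  apply/seteqP; split=> w /=; rewrite /loc_time; last by case: ifP.
  by case: ifP => // _ uE; have := uT n; rewrite uE ltxx.
have mA n : measurable [set w | agree n w].
  apply: (FM_filtration.1 (u n)%:E _).2; first by rewrite lee_fin.
  exact: agree_measurable.
have mB n : measurable [set w | loc_time n w = tG G] by rewrite loc_timeE; exact: measurableC.
have mU : measurable (\bigcup_n [set w | loc_time n w = tG G]) by exact: bigcup_measurable.
have -> : 1%E = P (\bigcup_n [set w | loc_time n w = tG G]).
  apply/eqP; rewrite eq_le probability_le1// andbT -(gamma_lt_tG j0).
  apply: le_measure; rewrite ?inE//.
    exact: measurable_gamma_lt.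
  move=> w /= wT; apply: contrapT => nw.
  have aw n : agree n w.
    by apply: contrapT => na; apply: nw; exists n => //; rewrite loc_timeE.
  (* if all the values agreed, F would be constant along u after the jump *)
  have FZ : \forall n \near \oo, F (u n) = AG G F dF (gamma w).
    near=> n; rewrite -(@MG_after (u n)%:E w).
      by apply/esym/eqP; have := aw n; case: (n) => [|m] /= /andP[].
    by rewrite lee_fin ltW//; near: n; exact: ua.
  have FG := cvg_up_to_seq (tG_neqNy G0) uT ua (cvg_FGbar_tG G0 hdF AG_integrable_before).
  have Gb := cvg_up_to_seq (tG_neqNy G0) uT ua (cvg_Gbar_tG G0).
  have ZG : F (u n) * Gbar G (u n) @[n --> \oo] --> AG G F dF (gamma w) * jump_tG G.
    have := cvgM (cvg_cst (AG G F dF (gamma w))) Gb.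
    move=> /(_ _ _) H; apply: cvg_trans H; apply: near_eq_cvg; near=> n.
    by rewrite /=; congr (_ * _); apply/esym; near: n.
  move/eqP : L0; apply; rewrite (cvg_lim _ (cvg_FGbar_tG G0 hdF AG_integrable_before))//.
  by rewrite -(cvg_lim _ FG)// (cvg_lim _ ZG)// j0 mulr0.
apply: nondecreasing_cvg_mu => //.
apply/nondecreasing_seqP => n; apply/subsetPset => w /=; rewrite -!/([set w | loc_time _ w = _] w).
move=> nE; apply/eqP; rewrite eq_le; have := loc_time_nondecreasing n w; rewrite nE => ->.
by have [/(_ w)/andP[_ ->]] := loc_stopping_time n.+1.
Unshelve. all: by end_near. Qed.

End localization.

Lemma MG_local_martingale : local_martingale_on P FM (Fgamma gamma) (tG G) M.
Proof.
split; [exact: Fgamma_filtration|exact: FM_filtration|exact: FM_sub_Fgamma|].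
have T0 := tG_gt0 G0.
have [d0|d0] := eqVneq dmu 0.
  exists (fun _ => cst (tG G)); split => //.
  - move=> n; split=> [w|t t0]; first by rewrite /= lexx ltW.
    have St : sigma_algebra setT (FM t) by exact: smallest_sigma_algebra.
    have [Tt|tT] := leP (tG G) t.
      by rewrite (_ : [set _ | _] = setT); [exact: (sigma_setT St)|apply/seteqP; split].
    rewrite (_ : [set _ | _] = set0); first exact: (sigma_set0 St).
    by apply/seteqP; split=> w //=; rewrite leNgt tT.
  - by move=> n; apply: MG_stopped_martingale => //; exact: ltW.
  - apply: cvg_near_cst; apply: nearW => n.
    by rewrite (_ : [set _ | _] = setT) ?probability_setT//; apply/seteqP; split.
have [u [u0 uT und ua]] := increasing_to T0.
exists (loc_time u); split.
- by move=> n; exact: loc_stopping_time.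
- by move=> n w; exact: loc_time_nondecreasing.
- move=> n; rewrite stopped_loc_time//; apply: MG_stopped_martingale; rewrite ?lee_fin//.
    exact: ltW.
  by move=> uE; have := uT n; rewrite uE ltxx.
- exact: loc_time_cvg.
Qed.

(** * The sign of the defect *)

(** The sigma-algebra at time [0] is arbitrary, but it contains the whole space and
    [M 0] is the constant [F 0]: comparing means only needs these two facts. *)
Lemma rel_martingale_endpoints (rel : R -> R -> Prop) FF :
  rel_martingale_on P rel (tG G) FF M -> exists Y : Omega -> R,
  [/\ P.-integrable setT (EFin \o Y), {ae P, forall w, rel (Y w) (F 0)} &
     (\int[P]_w (Y w)%:E = (F 0 + dmu)%:E)%E].
Proof.
move=> [[FFs _] _ _ _ H]; have T0 := ltW (tG_gt0 G0).
have [Y [mY Yi YE] relY] := H 0%E (tG G) (lexx _) T0 (lexx _).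
exists Y; split=> //.
  by apply: filterS relY => w; rewrite MG_0.
rewrite YE; first by rewrite integral_MG// eqxx.
exact: (sigma_setT (FFs 0%E (lexx _)).1).
Qed.

Lemma submartingale_dmu FF : submartingale_on P (tG G) FF M -> 0 <= dmu.
Proof.
move=> /rel_martingale_endpoints[Y [Yi FY YE]].
have Fi : P.-integrable setT (EFin \o cst (F 0)).
  exact: finite_measure_integrable_cst.
have := ae_le_integral Fi Yi FY; rewrite YE /=.
by rewrite integral_cst// [X in (_ * X)%E]probability_setT mule1 lee_fin lerDl.
Qed.

Lemma supermartingale_dmu FF : supermartingale_on P (tG G) FF M -> dmu <= 0.
Proof.
move=> /rel_martingale_endpoints[Y [Yi FY YE]].
have Fi : P.-integrable setT (EFin \o cst (F 0)).
  exact: finite_measure_integrable_cst.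
have := ae_le_integral Yi Fi FY; rewrite YE /=.
by rewrite integral_cst// [X in (_ * X)%E]probability_setT mule1 lee_fin gerDl.
Qed.

Lemma martingale_dmu FF : martingale_on P (tG G) FF M -> dmu = 0.
Proof.
move=> [h1 h2 h3 h4 h5]; apply/eqP; rewrite eq_le; apply/andP; split.
  apply: (@supermartingale_dmu FF); split=> // s t s0 st tT.
  have [Y cY YE] := h5 s t s0 st tT; exists Y => //.
  by apply: filterS YE => w ->.
apply: (@submartingale_dmu FF); split=> // s t s0 st tT.
have [Y cY YE] := h5 s t s0 st tT; exists Y => //.
by apply: filterS YE => w ->.
Qed.

(** [M] is a local martingale in any case, and a martingale in some filtration
    exactly when it is one in the filtration of the jump. *)
Lemma strict_local_MG : strict_local_martingale_on P (tG G) M <-> dmu != 0.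
Proof.
split=> [[_ nM]|d0].
  apply/eqP => d0; apply: nM; exists (Fgamma gamma).
  by apply: MG_rel_martingale => x r _; rewrite d0 mul0r addr0.
split; last by move=> [FF /martingale_dmu /eqP]; rewrite (negbTE d0).
exists (Fgamma gamma).
have [h1 _ sub [tau [t1 t2 t3 t4]]] := MG_local_martingale.
split; [exact: h1|exact: h1|by move=> t _ A|exists tau].
split; [move=> n|exact: t2|exact: t3|exact: t4].
by have [a b] := t1 n; split=> // t t0; apply: sub => //; exact: b.
Qed.

Lemma submartingale_MG : submartingale_on P (tG G) (Fgamma gamma) M <-> 0 <= dmu.
Proof.
split; first exact: submartingale_dmu.
by move=> d0; apply: MG_rel_martingale => x r r0; rewrite lerDl mulr_ge0.
Qed.

Lemma supermartingale_MG : supermartingale_on P (tG G) (Fgamma gamma) M <-> dmu <= 0.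
Proof.
split; first exact: supermartingale_dmu.
by move=> d0; apply: MG_rel_martingale => x r r0; rewrite gerDl mulr_le0_ge0.
Qed.

Lemma martingale_MG : martingale_on P (tG G) (Fgamma gamma) M <-> dmu = 0.
Proof.
split; first exact: martingale_dmu.
by move=> d0; apply: MG_rel_martingale => x r r0; rewrite d0 mul0r addr0.
Qed.

End single_jump_process.

Theorem lemma3p7 (R : realType) (G : cumulativeBounded (0 : R) (1 : R))
  (hG0 : G 0 = 0)
  (d : measure_display) (Omega : measurableType d) (P : probability Omega R)
  (gamma : {RV P >-> R})
  (gamma_gt0 : forall w, 0 < gamma w)
  (gamma_cdf : forall t : R, cdf gamma t = (G t)%:E)
  (F dF : R -> R)
  (hF : loc_abs_cont G F)
  (hdF : local_density G F dF) :
  let M : \bar R -> Omega -> R := MG gamma G F dF in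
  let FM : \bar R -> set (set Omega) := generated_filtration M in
  let Fg : \bar R -> set (set Omega) := Fgamma gamma in
  let dmu : R := fine 'E_P[M (tG G)] - fine 'E_P[M 0%E] in
  integrable_on P (tG G) M ->
  (cvg (F t * Gbar G t @[t --> up_to (tG G)]) /\
   dmu = - (lim (F t * Gbar G t @[t --> up_to (tG G)])
            * (jump_tG G == 0)%R%:R)) /\
  (forall s : R, 0 <= s -> (s%:E < tG G)%E ->
     exists2 Y : Omega -> R, is_cond_exp P (Fg s%:E) (M (tG G)) Y &
       {ae P, forall w,
          Y w - M s%:E w = dmu / Gbar G s * (s < gamma w)%R%:R}) /\
  (integrable_on P (tG G) M /\ local_martingale_on P FM Fg (tG G) M) /\
  ((submartingale_on P (tG G) Fg M /\ strict_local_martingale_on P (tG G) M)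
     <-> 0 < dmu) /\
  (martingale_on P (tG G) Fg M <-> dmu = 0) /\
  ((supermartingale_on P (tG G) Fg M /\ strict_local_martingale_on P (tG G) M)
     <-> dmu < 0).
Proof.
move=> M FM Fg dmu hM.
split; last split; last split; last split; last split.
- split; last exact: (dmuE hG0 gamma_gt0 gamma_cdf hdF hM).
  apply/cvg_ex; eexists; apply: (cvg_FGbar_tG hG0 hdF).
  exact: (AG_integrable_before hG0 gamma_gt0 gamma_cdf hdF hM).
- move=> s s0 sT.
  have := MG_cond_exp hG0 gamma_gt0 gamma_cdf hdF hM (s := s%:E) s0 (ltW sT) (lexx _).
  rewrite eqxx lt_eqF//= => ce; eexists; first exact: ce.
  by apply: aeW => w; rewrite /= lte_fin addrAC subrr add0r.
- by split=> //; exact: MG_local_martingale.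
- rewrite (submartingale_MG hG0 gamma_gt0 gamma_cdf hdF hM).
  rewrite (strict_local_MG hG0 gamma_gt0 gamma_cdf hdF hM) -/dmu.
  by rewrite lt0r; split=> [[-> ->]|/andP[-> ->]].
- exact: martingale_MG.
- rewrite (supermartingale_MG hG0 gamma_gt0 gamma_cdf hdF hM).
  rewrite (strict_local_MG hG0 gamma_gt0 gamma_cdf hdF hM) -/dmu.
  by rewrite lt_neqAle; split=> [[-> ->]|/andP[-> ->]].
Qed.
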